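(* Assume that there are constants $C_0>0$ and $C_{\mathrm{SP}}'\ge0$, independent of $h$, such that $$\|R_h\boldsymbol{\rho}\|_{L^p(\Omega)}\le C_0\|\boldsymbol{\rho}\|_{L^p(\Omega)}+C_{\mathrm{SP}}'\|\nabla\cdot\boldsymbol{\rho}\|_{W^{-1,p}(\Omega)}\qquad\forall\,\boldsymbol{\rho}\in L^p(\Omega)^2 ,$$ and that $f_1\in L^p(\Omega)$. Then $$\|\boldsymbol{\sigma}-\boldsymbol{\sigma}_h\|_{L^p(\Omega)}\le(1+C_0)\inf_{\boldsymbol{\tau}_h\in \mathrm{RT}_0^{f_1}(\mathcal T_h)}\|\boldsymbol{\sigma}-\boldsymbol{\tau}_h\|_{L^p(\Omega)}+C_{\mathrm P}\,C_{\mathrm{SP}}'\,h\,\|f_1-Q_hf_1\|_{L^p(\Omega)} ,$$ where $C_{\mathrm P}$ is the Poincaré constant defined in the context, which depends only on $p$ and on the shape regularity of $\mathcal T_h$.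
   Context: Continuous problem. $\Omega\subset\mathbb R^2$ is a bounded, simply connected Lipschitz domain, $x_0\in\Omega$, $1<p<2$, $p'=p/(p-1)$. The matrix field $A\in L^\infty(\Omega;\mathbb R^{2\times 2})$ is symmetric and uniformly elliptic: $\alpha|\xi|^2\le\xi^TA(x)\xi\le\beta|\xi|^2$ for all $\xi\in\mathbb R^2$ and a.e. $x\in\Omega$, with $0<\alpha\le\beta$. Data: $f_1\in L^p(\Omega)$, $g\in W^{1-1/p,p}(\partial\Omega)$. It is assumed that $-\nabla\cdot(A\nabla u)=f_1+\delta_{x_0}$ in $\Omega$, $u=g$ on $\partial\Omega$, has a unique solution $u\in W^{1,p}(\Omega)$. Let $\mathbf f_2(x):=\frac1{2\pi}\frac{x-x_0}{|x-x_0|^2}$ (so $\nabla\cdot\mathbf f_2=\delta_{x_0}$ in the sense of distributions, $\mathbf f_2\in L^p(\Omega)^2$) and let $\boldsymbol{\sigma}:=-A\nabla u-\mathbf f_2\in L^p(\Omega)^2$ be the modified flux; it satisfies $\nabla\cdot\boldsymbol{\sigma}=f_1$. Discrete problem. $\mathcal T_h$ is a shape-regular triangulation of $\Omega$, $h_K=\operatorname{diam}K$, $h=\max_{K\in\mathcal T_h}h_K$. $\mathrm{RT}_0(\mathcal T_h)$ is the space of $\boldsymbol{\tau}_h\in H(\mathrm{div};\Omega)$ with $\boldsymbol{\tau}_h|_K(x)=\mathbf a+bx$, $\mathbf a\in\mathbb R^2$, $b\in\mathbb R$, on each $K\in\mathcal T_h$; $P_0(\mathcal T_h)$ is the space of piecewise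 constant functions; $(Q_hf)|_K:=|K|^{-1}\int_Kf\,dx$. $(\cdot,\cdot)$ denotes the integral over $\Omega$ of the product. The pair $(\boldsymbol{\sigma}_h,u_h)\in\mathrm{RT}_0(\mathcal T_h)\times P_0(\mathcal T_h)$ is the unique solution of $$(A^{-1}\boldsymbol{\sigma}_h,\boldsymbol{\tau}_h)-(\nabla\cdot\boldsymbol{\tau}_h,u_h)=-(A^{-1}\mathbf f_2,\boldsymbol{\tau}_h)-\langle\boldsymbol{\tau}_h\cdot\mathbf n,g\rangle_{\partial\Omega}\quad\forall\boldsymbol{\tau}_h\in\mathrm{RT}_0(\mathcal T_h),$$ $$(\nabla\cdot\boldsymbol{\sigma}_h,v_h)=(f_1,v_h)\quad\forall v_h\in P_0(\mathcal T_h).$$ $K_h:=\{\boldsymbol{\tau}_h\in\mathrm{RT}_0(\mathcal T_h):\nabla\cdot\boldsymbol{\tau}_h=0\}$ and $\mathrm{RT}_0^{f_1}(\mathcal T_h):=\{\boldsymbol{\tau}_h\in\mathrm{RT}_0(\mathcal T_h):\nabla\cdot\boldsymbol{\tau}_h=Q_hf_1\}$. For $\boldsymbol{\rho}\in L^p(\Omega)^2$, $R_h\boldsymbol{\rho}\in K_h$ is defined by $(A^{-1}R_h\boldsymbol{\rho},\boldsymbol{\tau}_h)=(A^{-1}\boldsymbol{\rho},\boldsymbol{\tau}_h)$ for all $\boldsymbol{\tau}_h\in K_h$. Negative norm. $W^{-1,p}(\Omega)$ is the dual of $W_0^{1,p'}(\Omega)$ with $\|F\|_{W^{-1,p}(\Omega)}:=\sup_{0\ne\chi\in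 W^{1,p'}_0(\Omega)}\langle F,\chi\rangle/\|\nabla\chi\|_{L^{p'}(\Omega)}$, and $\nabla\cdot\boldsymbol{\rho}$ acts by $\langle\nabla\cdot\boldsymbol{\rho},\chi\rangle=-\int_\Omega\boldsymbol{\rho}\cdot\nabla\chi\,dx$. Poincaré constant. $C_{\mathrm P}$ is a constant, depending only on $p$ and the shape regularity of $\mathcal T_h$, with $\|\chi-Q_h\chi\|_{L^{p'}(K)}\le C_{\mathrm P}h_K\|\nabla\chi\|_{L^{p'}(K)}$ for all $K\in\mathcal T_h$ and $\chi\in W^{1,p'}(K)$. *)

(* Defs.v *)
From HB Require Import structures.
From mathcomp Require Import all_boot all_order all_algebra.
From mathcomp Require Import all_classical all_reals all_analysis.

Set Implicit Arguments.
Unset Strict Implicit.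
Unset Printing Implicit Defensive.

Import Order.TTheory GRing.Theory Num.Theory.
Import numFieldNormedType.Exports.

Local Open Scope classical_set_scope.
Local Open Scope ring_scope.

(* The plane is R * R.  The norm carried by this type in the library is the
   max norm; Euclidean lengths are written enorm. *)

(* The plane as a measurable space: R * R with its Borel sigma-algebra. *)
Notation mplane R := (measurableTypeR R * measurableTypeR R)%type.

Section Plane.
Context {R : realType}.
Implicit Types x y : R * R.

Definition dot x y : R := x.1 * y.1 + x.2 * y.2.

Definition enorm x : R := Num.sqrt (dot x x).

Definition mxapp (M : 'M[R]_2) x : R * R :=
  (M ord0 ord0 * x.1 + M ord0 ord_max * x.2,
   M ord_max ord0 * x.1 + M ord_max ord_max * x.2).

Definition leb2 : {measure set (mplane R) -> \bar R} :=
  (@lebesgue_measure R \x @lebesgue_measure R)%E.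

Definition ediam (U : set (R * R)) : \bar R :=
  ereal_sup (0%E |` [set z | exists x y, [/\ U x, U y & z = (enorm (x - y))%:E]]).

Definition diam (U : set (R * R)) : R := fine (ediam U).

Definition boundary (D : set (R * R)) : set (R * R) := closure D `\` D°.

(* One-dimensional Hausdorff (outer) measure, normalised so that a segment
   has its length as measure. *)
Definition hausdorff1 (B : set (R * R)) : \bar R :=
  ereal_sup [set m | exists2 delta : R, 0 < delta &
    m = ereal_inf [set s | exists U : nat -> set (R * R),
      [/\ B `<=` \bigcup_k U k,
          forall k, (ediam (U k) <= delta%:E)%E &
          s = (\sum_(0 <= k <oo) ediam (U k))%E]]].

(* [ds] is the arc length measure of the boundary of [D], seen as a Borel
   measure on the plane that is concentrated on this boundary. *)
Definition is_surface_measure (D : set (R * R))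
    (ds : {measure set (mplane R) -> \bar R}) : Prop :=
  forall B : set (mplane R), measurable B -> ds B = hausdorff1 (B `&` boundary D).

End Plane.

Section Domains.
Context {R : realType}.
Implicit Types D : set (R * R).

(* Every loop in [D] contracts, through loops in [D], to a constant loop. *)
Definition simply_connected D : Prop :=
  connected D /\
  forall gamma : R -> R * R,
    {within `[0, 1], continuous gamma} ->
    (forall t : R, t \in `[0, 1] -> D (gamma t)) ->
    gamma 0 = gamma 1 ->
    exists (H : R * R -> R * R) (c : R * R),
      [/\ {within `[0, 1] `*` `[0, 1], continuous H},
          forall s t : R, s \in `[0, 1] -> t \in `[0, 1] -> D (H (s, t)),
          forall t : R, t \in `[0, 1] -> H (0, t) = gamma t,
          forall t : R, t \in `[0, 1] -> H (1, t) = c &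
          forall s : R, s \in `[0, 1] -> H (s, 0) = H (s, 1)].

(* Near each boundary point, and in suitable orthonormal coordinates
   (with second axis [e]), [D] is the region above a Lipschitz graph. *)
Definition lipschitz_boundary D : Prop :=
  forall x, boundary D x ->
    exists (e : R * R) (gamma : R -> R) (L delta : R),
      [/\ enorm e = 1, 0 < delta,
          forall s t, `|gamma s - gamma t| <= L * `|s - t| &
          forall y, enorm (y - x) < delta ->
            (D y <-> gamma (dot y (e.2, - e.1)) < dot y e)].

Definition bounded_simply_connected_lipschitz_domain D : Prop :=
  [/\ open D, bounded_set D, simply_connected D & lipschitz_boundary D].

End Domains.

Section FunctionSpaces.
Context {R : realType}.
Implicit Types (D : set (R * R)) (u phi chi g : R * R -> R)
  (v rho tau : R * R -> R * R) (p : \bar R).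

(* Elements of Lebesgue and Sobolev spaces are represented by Borel functions;
   only their values in [D] matter. *)
Definition inL D p u : Prop := u \_ D \in Lfun leb2 p.

Definition inLv D p v : Prop := inL D p (fst \o v) /\ inL D p (snd \o v).

Definition normL D p u : \bar R := Lnorm leb2 p (EFin \o (u \_ D)).

Definition normLv D p v : \bar R := normL D p (enorm \o v).

Definition ip D u1 u2 : R := \int[leb2]_(x in D) (u1 x * u2 x).

Definition ipv D v1 v2 : R := \int[leb2]_(x in D) dot (v1 x) (v2 x).

Definition grad u (x : R * R) : R * R := ('D_(1, 0) u x, 'D_(0, 1) u x).

Fixpoint Ck (n : nat) u : Prop :=
  continuous u /\
  if n is m.+1 then
    [/\ forall x, derivable u x (1, 0) /\ derivable u x (0, 1),
        Ck m (fun x => 'D_(1, 0) u x) & Ck m (fun x => 'D_(0, 1) u x)]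
  else True.

Definition smooth u : Prop := forall n, Ck n u.

(* C_c^oo(D) *)
Definition test_fun D phi : Prop :=
  smooth phi /\
  exists K : set (R * R),
    [/\ compact K, K `<=` D & forall x, ~ K x -> phi x = 0].

Definition weak_grad D u Du : Prop :=
  forall phi, test_fun D phi ->
    \int[leb2]_(x in D) (u x * (grad phi x).1) = - ip D (fst \o Du) phi /\
    \int[leb2]_(x in D) (u x * (grad phi x).2) = - ip D (snd \o Du) phi.

Definition weak_div D v d : Prop :=
  forall phi, test_fun D phi -> ipv D v (grad phi) = - ip D d phi.

(* [u] is in W^{1,p}(D) and its weak gradient is [Du]. *)
Definition W1 D p u Du : Prop :=
  [/\ inL D p u, inLv D p Du & weak_grad D u Du].

(* Convergence of the smooth functions [phi n] to [u] in W^{1,p}(D). *)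
Definition cvgW1 D p (phi : nat -> R * R -> R) u Du : Prop :=
  normL D p (fun x => u x - phi n x) @[n --> \oo] --> 0%E /\
  normLv D p (fun x => Du x - grad (phi n) x) @[n --> \oo] --> 0%E.

(* W_0^{1,p}(D), the closure of C_c^oo(D) in W^{1,p}(D) *)
Definition W10 D p u Du : Prop :=
  W1 D p u Du /\
  exists phi : nat -> R * R -> R,
    (forall n, test_fun D (phi n)) /\ cvgW1 D p phi u Du.

(* The norm of the divergence of [rho] in W^{-1,p}(D), the dual of
   W_0^{1,p'}(D); the argument [q] is the conjugate exponent p'. *)
Definition norm_divW D (q : R) rho : \bar R :=
  ereal_sup [set z | exists chi Dchi,
    [/\ W10 D q%:E chi Dchi,
        ~ {ae leb2, forall x, D x -> chi x = 0} &
        z = ((- ipv D rho Dchi) / fine (normLv D q%:E Dchi))%:E]].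

(* W^{1-1/p,p} of the boundary of [D] (Sobolev-Slobodeckij space): for a curve
   the exponent 1 + (1 - 1/p) p of |x - y| is p. *)
Definition slobodeckij (ds : {measure set (mplane R) -> \bar R}) (p : R) g : Prop :=
  g \in Lfun ds p%:E /\
  (\int[ds]_x \int[ds]_y ((`|g x - g y| `^ p) / (enorm (x - y) `^ p))%:E < +oo)%E.

(* The trace on the boundary of [D], i.e. the continuous extension to
   W^{1,p}(D) of the restriction of smooth functions to the boundary. *)
Definition has_trace D (ds : {measure set (mplane R) -> \bar R}) p u Du g : Prop :=
  exists phi : nat -> R * R -> R,
    [/\ forall n, smooth (phi n), cvgW1 D p phi u Du &
        Lnorm ds p (EFin \o (fun x => g x - phi n x)) @[n --> \oo] --> 0%E].

(* [l] is the value at [g] of the normal trace of the field [tau] whose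
   divergence is [d].  The normal trace of a field in H(div) is the functional
   on boundary traces given by (tau, grad w) + (div tau, w) for any
   extension w of [g]. *)
Definition normal_trace_pairing D ds (p : R) tau d g (l : R) : Prop :=
  forall w Dw, W1 D p%:E w Dw -> has_trace D ds p%:E w Dw g ->
    l = ipv D tau Dw + ip D d w.

End FunctionSpaces.

Section ContinuousProblem.
Context {R : realType}.
Implicit Types (D : set (R * R)) (A : R * R -> 'M[R]_2).

Definition admissible_coefficient D A (alpha beta : R) : Prop :=
  [/\ forall i j, inL D +oo%E (fun x => A x i j),
      {ae leb2, forall x, D x -> (A x)^T = A x} &
      {ae leb2, forall x, D x -> forall xi : R * R,
        alpha * enorm xi ^+ 2 <= dot xi (mxapp (A x) xi) /\
        dot xi (mxapp (A x) xi) <= beta * enorm xi ^+ 2}].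

Definition Aapp A (v : R * R -> R * R) (x : R * R) : R * R :=
  mxapp (A x) (v x).

Definition Ainv A (v : R * R -> R * R) (x : R * R) : R * R :=
  mxapp (invmx (A x)) (v x).

(* - div (A grad u) = f1 + (Dirac mass at x0) in D, u = g on the boundary *)
Definition weak_solution D ds (p : R) A (x0 : R * R) (f1 g : R * R -> R) u Du : Prop :=
  [/\ W1 D p%:E u Du, has_trace D ds p%:E u Du g &
      forall phi, test_fun D phi ->
        ipv D (Aapp A Du) (grad phi) = ip D f1 phi + phi x0].

Definition f2 (x0 x : R * R) : R * R :=
  (2 * pi)^-1 *: ((enorm (x - x0) ^+ 2)^-1 *: (x - x0)).

Definition modified_flux A (x0 : R * R) (Du : R * R -> R * R)
    (x : R * R) : R * R :=
  - Aapp A Du x - f2 x0 x.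

End ContinuousProblem.

Record mesh (R : realType) := Mesh {
  ncells : nat ;
  vertex : 'I_ncells -> 'I_3 -> R * R }.

Section Meshes.
Context {R : realType}.
Implicit Types (P : 'I_3 -> R * R) (T : mesh R) (D : set (R * R)).

(* The face of the triangle with vertices [P] spanned by the vertices selected
   by [J]: the triangle itself for [predT], the empty set for [pred0]. *)
Definition face P (J : pred 'I_3) : set (R * R) :=
  [set x | exists l : 'I_3 -> R,
    [/\ forall i, 0 <= l i, forall i, ~~ J i -> l i = 0,
        \sum_i l i = 1 & x = \sum_i l i *: P i]].

Definition cell T (k : 'I_(ncells T)) : set (R * R) := face (vertex k) predT.

Definition nondegenerate_triangle P : Prop :=
  forall (a b c : 'I_3), uniq [:: a; b; c] ->
    ((P b).1 - (P a).1) * ((P c).2 - (P a).2)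
      - ((P b).2 - (P a).2) * ((P c).1 - (P a).1) != 0.

(* Two different triangles meet in a common proper face: in nothing, a common
   vertex or a common edge. *)
Definition conforming T : Prop :=
  forall k k' : 'I_(ncells T), k != k' ->
    exists J J' : pred 'I_3,
      [/\ exists i, ~~ J i, exists i, ~~ J' i,
          cell k `&` cell k' = face (vertex k) J &
          cell k `&` cell k' = face (vertex k') J'].

Definition triangulation D T : Prop :=
  [/\ closure D = \bigcup_(k in [set: 'I_(ncells T)]) cell k,
      forall k : 'I_(ncells T), nondegenerate_triangle (vertex k) & conforming T].

Definition inball_diam (K : set (R * R)) : R :=
  sup [set s | exists (c : R * R) (r : R),
    [/\ 0 <= r, s = 2 * r & forall y, enorm (y - c) <= r -> K y]].

Definition shape_regular (kappa : R) T : Prop :=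
  forall k : 'I_(ncells T), diam (cell k) <= kappa * inball_diam (cell k).

Definition mesh_size T : R := \big[Num.max/0]_(k < ncells T) diam (cell k).

Definition cell_mean T (k : 'I_(ncells T)) (f : R * R -> R) : R :=
  (fine (leb2 (cell k)))^-1 * \int[leb2]_(x in cell k) f x.

(* Set to zero on the edges. *)
Definition Qh T (f : R * R -> R) (x : R * R) : R :=
  \sum_(k < ncells T) cell_mean k f * \1_((cell k)°) x.

End Meshes.

Section DiscreteProblem.
Context {R : realType}.
Implicit Types (D : set (R * R)) (T : mesh R) (A : R * R -> 'M[R]_2)
  (tau : R * R -> R * R) (d : R * R -> R).

Definition Hdiv D tau d : Prop :=
  [/\ inLv D 2%:E tau, inL D 2%:E d & weak_div D tau d].

(* [tau] is in RT_0(T) and its divergence is [d]. *)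
Definition RT0 D T tau d : Prop :=
  Hdiv D tau d /\
  forall k : 'I_(ncells T), exists (a : R * R) (b : R),
    {ae leb2, forall x, cell k x -> tau x = a + b *: x}.

Definition P0 D T (v : R * R -> R) : Prop :=
  measurable_fun D (v : mplane R -> R) /\
  forall k : 'I_(ncells T), exists c : R,
    {ae leb2, forall x, cell k x -> v x = c}.

Definition Kh D T tau : Prop := RT0 D T tau (cst 0).

Definition RT0f D T (f : R * R -> R) tau : Prop := RT0 D T tau (Qh T f).

(* [r] is the projection R_h rho. *)
Definition is_Rh D T A (rho r : R * R -> R * R) : Prop :=
  Kh D T r /\
  forall tau, Kh D T tau -> ipv D (Ainv A r) tau = ipv D (Ainv A rho) tau.

Definition mixed_solution D ds (p : R) T A (x0 : R * R) (f1 g : R * R -> R)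
    (sigmah : R * R -> R * R) (uh : R * R -> R) : Prop :=
  exists dsigmah,
    [/\ RT0 D T sigmah dsigmah, P0 D T uh,
        forall tau d, RT0 D T tau d ->
          exists2 l, normal_trace_pairing D ds p tau d g l &
            ipv D (Ainv A sigmah) tau - ip D d uh
              = - ipv D (Ainv A (f2 x0)) tau - l &
        forall v, P0 D T v -> ip D dsigmah v = ip D f1 v].

(* On a single triangle Qh T chi is the mean of chi. *)
Definition poincare_constant T (q C : R) : Prop :=
  0 <= C /\
  forall (k : 'I_(ncells T)) chi Dchi,
    W1 (cell k)° q%:E chi Dchi ->
    (normL (cell k)° q%:E (fun x => (chi x - Qh T chi x)%R)
      <= (C * diam (cell k))%:E * normLv (cell k)° q%:E Dchi)%E.

End DiscreteProblem.

(* Main.v *)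
Require Import Defs.
From HB Require Import structures.
From mathcomp Require Import all_boot all_order all_algebra.
From mathcomp Require Import all_classical all_reals all_analysis.
From mathcomp Require Import measurable_realfun ring lra.
Set Implicit Arguments.
Unset Strict Implicit.
Unset Printing Implicit Defensive.
Import Order.TTheory GRing.Theory Num.Theory.
Import numFieldNormedType.Exports.
Import HBNNSimple.
Local Open Scope classical_set_scope.
Local Open Scope ring_scope.

(** The flux error splits through an arbitrary competitor tau in RT_0 with
    div tau = Q_h f1: sigma - sigma_h = rho - r with rho = sigma - tau and
    r = sigma_h - tau. If rho is not in L^p, the estimate for tau is trivial.
    Otherwise the proof rests on two facts.

    The first (discrete_error_is_Rh) is r = R_h rho. The discrete field r is
    divergence free since the discrete equation forces div sigma_h = Q_h f1
    (ip_discrete_divergence): the divergence of a field a + b x is the constant 2 b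
    on each triangle (RT0_cell_divergence), so testing with indicators of triangles
    determines it. For divergence-free discrete fields q the mixed equation,
    with the boundary term evaluated by means of the extension u of g, reads
    (A^-1 sigma_h, q) = - (A^-1 f_2, q) - (grad u, q) = (A^-1 sigma, q).

    The second (norm_divW_le) is that the norm of div rho in W^{-1,p} is at most
    C_P h |f1 - Q_h f1|. Indeed div rho = f1 - Q_h f1
    (flux_error_divergence); as f1 - Q_h f1 is orthogonal to piecewise constants,
    (f1 - Q_h f1, chi) = (f1 - Q_h f1, chi - Q_h chi), and the Poincare
    inequality on each triangle applies.

    The stability of R_h then bounds r by C_0 |rho| + C_SP' C_P h |f1 - Q_h f1|
    (competitor_estimate), and the infimum over tau concludes.

    Two ingredients of the identities above take most of the work. That the
    divergence of f_2 is the point mass (integral_point_source) is shown by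
    integration by parts along lines, with the arctangent as primitive; by Fubini
    almost every line avoids the singularity. That the divergence of a discrete
    field can be computed on one triangle uses smooth cutoffs of the triangle,
    products of functions exp(-1/t) of the barycentric coordinates, and the geometry
    of the triangulation: edges are null sets (leb2_line), and open triangles lie in
    the domain because a Lipschitz domain is the interior of its closure
    (interior_closure_lipschitz). *)

(** * Changes on null sets *)

Section null_sets.
Context d (T : measurableType d) (R : realType) (mu : {measure set T -> \bar R}).
Implicit Types (D N : set T).
Local Open Scope ereal_scope.

(** The functions are arbitrary because the mean of the load over a closed triangle
    involves its values on the boundary of the domain, where the load need not be
    measurable. The integral is the supremum of the integrals of the simple
    functions below, and cutting a simple function off on a null set leaves its
    integral unchanged. *)
Lemma ge0_integral_le_null (f g : T -> \bar R) :
  (forall x, 0 <= f x) -> (forall x, 0 <= g x) ->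
  {ae mu, forall x, f x <= g x} -> \int[mu]_x f x <= \int[mu]_x g x.
Proof.
move=> f0 g0 [N [mN N0 fgN]]; rewrite !ge0_integralTE//.
apply: ge_ereal_sup => /= _ [h hf <-].
have mNC : measurable (~` N) by exact: measurableC.
rewrite (_ : sintegral mu h = sintegral mu (proj_nnsfun h mNC)).
  apply: ereal_sup_ubound => /=; exists (proj_nnsfun h mNC) => // x.
  rewrite -mrestrict patchE; case: ifPn => // /set_mem xN.
  apply: le_trans (hf x) _; apply: contrapT => nfg; exact/xN/fgN.
rewrite -!integralT_nnsfun; apply: ge0_ae_eq_integral => //.
- exact/measurable_EFinP.
- exact/measurable_EFinP.
- by move=> x _; rewrite lee_fin.
- by move=> x _; rewrite lee_fin.
exists N; split=> // x nx; apply: contrapT => Nx; apply: nx => _.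
have := congr1 (@^~ x) (mrestrict h mNC); rewrite patchE mem_set// => hx.
by rewrite [LHS](congr1 EFin hx).
Qed.

Lemma ae_ext_integral D (f g : T -> \bar R) :
  {ae mu, forall x, D x -> f x = g x} ->
  \int[mu]_(x in D) f x = \int[mu]_(x in D) g x.
Proof.
move=> fg; rewrite [LHS]integral_mkcond [RHS]integral_mkcond.
have {}fg : {ae mu, forall x, (f \_ D) x = (g \_ D) x}.
  apply: filterS fg => x /= fgx; rewrite !patchE.
  by case: ifPn => // /set_mem /fgx.
rewrite integralE [RHS]integralE; congr (_ - _); apply/eqP; rewrite eq_le;
  apply/andP; split; apply: ge0_integral_le_null => //;
  by apply: filterS fg => x /= e; rewrite ?funeposE ?funenegE e.
Qed.

Lemma ae_ext_Rintegral D (f g : T -> R) :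
  {ae mu, forall x, D x -> f x = g x} ->
  (\int[mu]_(x in D) f x = \int[mu]_(x in D) g x)%R.
Proof.
move=> fg; congr fine; apply: ae_ext_integral.
by apply: filterS fg => x /= fgx Dx; rewrite fgx.
Qed.

Lemma le_Lnorm_ae (p : R) (f g : T -> R) : (0 < p)%R ->
  {ae mu, forall x, (`|f x| <= `|g x|)%R} ->
  Lnorm mu p%:E (EFin \o f) <= Lnorm mu p%:E (EFin \o g).
Proof.
move=> p0 fg; rewrite unlock.
apply: gt0_ler_poweR; first by rewrite invr_ge0 ltW.
- by rewrite in_itv/= leey andbT integral_ge0// => x _; exact: poweR_ge0.
- by rewrite in_itv/= leey andbT integral_ge0// => x _; exact: poweR_ge0.
apply: ge0_integral_le_null; [by move=> x; exact: poweR_ge0..|].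
apply: filterS fg => x /= fgx; rewrite !lee_fin.
by apply: ge0_ler_powR => //; rewrite ?nnegrE// ltW.
Qed.

Lemma integrable_ae_le D (f g : T -> \bar R) : measurable D ->
  measurable_fun D f -> {ae mu, forall x, D x -> `|f x| <= `|g x|} ->
  mu.-integrable D g -> mu.-integrable D f.
Proof.
move=> mD mf fg /integrableP[mg gi]; apply/integrableP; split => //.
apply: le_lt_trans gi; rewrite integral_mkcond [leRHS]integral_mkcond.
apply: ge0_integral_le_null.
- by move=> x; rewrite patchE; case: ifP.
- by move=> x; rewrite patchE; case: ifP.
by apply: filterS fg => x /= h; rewrite !patchE; case: ifPn => // /set_mem /h.
Qed.

End null_sets.

(** * Measurability in the plane *)

Section plane_measurability.
Context {R : realType}.

Lemma open_measurable_plane (U : set (R * R)) : open U ->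
  measurable (U : set (mplane R)).
Proof.
move=> oU.
pose box (q : (rat * rat) * (rat * rat)) : set (mplane R) :=
  [set` `](ratr q.1.1 : R), (ratr q.1.2 : R)[] `*`
  [set` `](ratr q.2.1 : R), (ratr q.2.2 : R)[].
rewrite (_ : (U : set (mplane R)) = \bigcup_q (if `[< box q `<=` U >] then box q else set0)).
  apply: countable_bigcupT_measurable => [|q]; first exact: countableP.
  case: ifP => // _; apply: measurableX; exact: measurable_itv.
apply/seteqP; split=> [x Ux|x [q _]]; last first.
  by case: ifPn => // /asboolP; exact.
have : nbhs (x : R * R) U by apply: open_nbhs_nbhs; split.
case=> -[U1 U2] /= [/nbhs_ballP[e1 /= e10 eU1] /nbhs_ballP[e2 /= e20 eU2]] U12.
have rat_in (a b : R) : a < b -> exists q : rat, a < ratr q < b.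
  by move=> /rat_in_itvoo[q]; rewrite in_itv/= => qab; exists q.
have [a1] := rat_in (x.1 - e1) x.1 ltac:(lra).
have [b1] := rat_in x.1 (x.1 + e1) ltac:(lra).
have [a2] := rat_in (x.2 - e2) x.2 ltac:(lra).
have [b2] := rat_in x.2 (x.2 + e2) ltac:(lra).
move=> /andP[h1 h2] /andP[h3 h4] /andP[h5 h6] /andP[h7 h8].
exists ((a1, b1), (a2, b2)) => //; rewrite ifT; last first.
  apply/asboolP => y [/=]; rewrite !in_itv/= => /andP[? ?] /andP[? ?].
  by apply: U12; split; [apply: eU1|apply: eU2]; rewrite /ball/= ltr_norml; lra.
by split; rewrite /= in_itv/=; apply/andP.
Qed.

Lemma closed_measurable_plane (U : set (R * R)) : closed U ->
  measurable (U : set (mplane R)).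
Proof.
by move=> /closed_openC/open_measurable_plane/measurableC; rewrite setCK.
Qed.

Lemma continuous_measurable_plane (f : R * R -> R) : continuous f ->
  measurable_fun setT (f : mplane R -> R).
Proof.
move=> /continuousP cf; apply: (measurability _ (RGenOpens.measurableE R)).
move=> _ [_ [a [b ->] <-]]; rewrite setTI; apply: open_measurable_plane.
exact/cf/interval_open.
Qed.

Lemma measurable_inv : measurable_fun setT (fun x : R => x^-1).
Proof.
rewrite (_ : (fun x : R => x^-1) = (fun x => x * (x ^+ 2) `^ (-1))).
  apply: measurable_funM => //.
  apply: (measurableT_comp (measurable_powR _)); exact: measurable_funX.
apply/funext => x; rewrite powR_inv1 ?sqr_ge0//.
have [->|x0] := eqVneq x 0; first by rewrite invr0 mul0r.
by rewrite expr2 invfM mulrA divff// mul1r.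
Qed.

End plane_measurability.

(** * The Euclidean norm *)

Section euclidean_plane.
Context {R : realType}.
Implicit Types x y : R * R.

Lemma dotxx_ge0 x : 0 <= dot x x.
Proof. by rewrite /dot; nra. Qed.

Lemma enorm_ge0 x : 0 <= enorm x.
Proof. exact: sqrtr_ge0. Qed.

Lemma sqr_enorm x : enorm x ^+ 2 = dot x x.
Proof. by rewrite sqr_sqrtr// dotxx_ge0. Qed.

Lemma cauchy_schwarz x y : `|dot x y| <= enorm x * enorm y.
Proof.
rewrite -(ler_pXn2r (_ : 0 < 2)%N) ?nnegrE ?mulr_ge0 ?enorm_ge0//.
rewrite exprMn !sqr_enorm -normrX ger0_norm ?sqr_ge0// /dot.
by have := sqr_ge0 (x.1 * y.2 - x.2 * y.1); nra.
Qed.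

Lemma ler_enormD x y : enorm (x + y) <= enorm x + enorm y.
Proof.
rewrite -(ler_pXn2r (_ : 0 < 2)%N) ?nnegrE ?addr_ge0 ?enorm_ge0//.
rewrite sqrrD !sqr_enorm mulr2n.
have := le_trans (ler_norm _) (cauchy_schwarz x y).
by rewrite /dot /=; nra.
Qed.

Lemma enormN x : enorm (- x) = enorm x.
Proof. by rewrite /enorm /dot/= !mulrNN. Qed.

Lemma enormZ a x : enorm (a *: x) = `|a| * enorm x.
Proof.
by rewrite /enorm -sqrtr_sqr -sqrtrM ?sqr_ge0// /dot/= /GRing.scale/=; congr Num.sqrt; ring.
Qed.

Lemma ler_fst_enorm x : `|x.1| <= enorm x.
Proof. by rewrite -sqrtr_sqr ler_wsqrtr// /dot; nra. Qed.

Lemma ler_snd_enorm x : `|x.2| <= enorm x.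
Proof. by rewrite -sqrtr_sqr ler_wsqrtr// /dot; nra. Qed.

Lemma enorm_ler_sum x : enorm x <= `|x.1| + `|x.2|.
Proof.
rewrite -(ler_pXn2r (_ : 0 < 2)%N) ?nnegrE ?addr_ge0 ?enorm_ge0//.
rewrite sqr_enorm sqrrD !real_normK ?num_real// /dot mulr2n.
by have := mulr_ge0 (normr_ge0 x.1) (normr_ge0 x.2); nra.
Qed.

Lemma measurable_dot d (T : measurableType d) (D : set T) (v w : T -> R * R) :
  measurable_fun D (fst \o v) -> measurable_fun D (snd \o v) ->
  measurable_fun D (fst \o w) -> measurable_fun D (snd \o w) ->
  measurable_fun D (fun t => dot (v t) (w t)).
Proof.
move=> *; rewrite (_ : (fun t => _) = (fun t => (fst \o v) t * (fst \o w) t +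
  (snd \o v) t * (snd \o w) t))//.
by apply: measurable_funD; exact: measurable_funM.
Qed.

Lemma measurable_enorm d (T : measurableType d) (D : set T) (v : T -> R * R) :
  measurable_fun D (fst \o v) -> measurable_fun D (snd \o v) ->
  measurable_fun D (enorm \o v).
Proof.
move=> m1 m2; rewrite (_ : enorm \o v = Num.sqrt \o (fun t => dot (v t) (v t)))//.
apply: (@measurableT_comp _ _ _ _ _ _ (@Num.sqrt R) _ (fun t => dot (v t) (v t)));
  last exact: measurable_dot.
by apply: continuous_measurable_fun; exact: sqrt_continuous.
Qed.

End euclidean_plane.

Lemma leb2_ae_filter (R : realType) : Filter (nbhs (almost_everywhere (@leb2 R))).
Proof. exact: ae_filter_ringOfSetsType. Qed.
#[local] Existing Instance leb2_ae_filter.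

(** * Lebesgue spaces *)

Section lebesgue_spaces.
Context {R : realType}.
Variable D : set (R * R).
Hypothesis mD : measurable (D : set (mplane R)).
Implicit Types (u w : R * R -> R) (v : R * R -> R * R) (p q : R).

Local Notation mfun u := (measurable_fun (D : set (mplane R)) (u : mplane R -> R)).

Lemma inLP (p : \bar R) u : inL D p u <-> mfun u /\ (normL D p u < +oo)%E.
Proof.
rewrite /inL /normL; split.
  by rewrite inE => /andP[]; rewrite !inE => mu fu; split => //;
    exact/(measurable_restrictT _ mD).
case=> /(measurable_restrictT _ mD) mu fu; rewrite inE; apply/andP.
by rewrite !inE.
Qed.

Lemma inL_mfun (p : \bar R) u : inL D p u -> mfun u.
Proof. by case/inLP. Qed.

Lemma normL_ge0 (p : \bar R) u : (0 <= normL D p u)%E.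
Proof. exact: Lnorm_ge0. Qed.

Lemma normLv_ge0 (p : \bar R) v : (0 <= normLv D p v)%E.
Proof. exact: Lnorm_ge0. Qed.

Lemma le_normL p u w : 0 < p ->
  {ae leb2, forall x, D x -> `|u x| <= `|w x|} ->
  (normL D p%:E u <= normL D p%:E w)%E.
Proof.
move=> p0 uw; apply: le_Lnorm_ae => //.
by apply: filterS uw => x h; rewrite !patchE; case: ifPn => // /set_mem /h.
Qed.

Lemma normL_normr p u : normL D p%:E (fun x => `|u x|) = normL D p%:E u.
Proof.
rewrite /normL -[RHS]Lnorm_abse; congr Lnorm; apply/funext => x /=.
by rewrite !patchE; case: ifPn => //= _; rewrite normr0.
Qed.

Lemma normLD p u w : 1 <= p -> mfun u -> mfun w ->
  (normL D p%:E (fun x => (u x + w x)%R) <= normL D p%:E u + normL D p%:E w)%E.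
Proof.
move=> p1 /(measurable_restrictT _ mD) mu /(measurable_restrictT _ mD) mw.
rewrite /normL; apply: le_trans (minkowski_EFin _ mu mw p1).
rewrite le_eqVlt; apply/orP; left; apply/eqP; congr Lnorm; apply/funext => x /=.
by rewrite !patchE; case: ifPn => //= _; rewrite addr0.
Qed.

Lemma normLvD p (v1 v2 : R * R -> R * R) : 1 <= p ->
  mfun (fst \o v1) -> mfun (snd \o v1) -> mfun (fst \o v2) -> mfun (snd \o v2) ->
  (normLv D p%:E (fun x => (v1 x + v2 x)%R)
    <= normLv D p%:E v1 + normLv D p%:E v2)%E.
Proof.
move=> p1 m11 m12 m21 m22.
have m1 := measurable_enorm m11 m12; have m2 := measurable_enorm m21 m22.
apply: le_trans (normLD p1 m1 m2); apply: le_normL; first exact: lt_le_trans p1.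
apply: aeW => x _ /=; rewrite !ger0_norm ?addr_ge0 ?enorm_ge0//.
exact: ler_enormD.
Qed.

Lemma normLvN p v : normLv D p%:E (fun x => - v x) = normLv D p%:E v.
Proof.
by rewrite /normLv; congr normL; apply/funext => x /=; rewrite enormN.
Qed.

Lemma inLvP p v : 1 <= p -> inLv D p%:E v <->
  [/\ mfun (fst \o v), mfun (snd \o v) & (normLv D p%:E v < +oo)%E].
Proof.
move=> p1; have p0 : 0 < p by exact: lt_le_trans p1.
rewrite /inLv !inLP; split=> [[[m1 f1] [m2 f2]]|[m1 m2 f]].
  split=> //; apply: (@le_lt_trans _ _ (normL D p%:E (fst \o v) + normL D p%:E (snd \o v))%E);
    last exact: lte_add_pinfty.
  rewrite -(normL_normr p (fst \o v)) -(normL_normr p (snd \o v)).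
  apply: le_trans (normLD p1 _ _); [|exact: measurableT_comp..].
  apply: le_normL => //; apply: aeW => x _ /=.
  by rewrite (ger0_norm (enorm_ge0 _)) (le_trans (enorm_ler_sum _))// ler_norm.
do 2 split=> //; apply: le_lt_trans f; apply: le_normL => //;
  apply: aeW => x _ /=; rewrite (ger0_norm (enorm_ge0 _));
  [exact: ler_fst_enorm|exact: ler_snd_enorm].
Qed.

Lemma inL_enorm p v : 1 <= p -> inLv D p%:E v -> inL D p%:E (enorm \o v).
Proof.
move=> p1 /(inLvP _ p1)[m1 m2 f]; apply/inLP; split=> //.
exact: measurable_enorm.
Qed.

Lemma hoelder_integrable p q u w : 0 < p -> 0 < q -> p^-1 + q^-1 = 1 ->
  inL D p%:E u -> inL D q%:E w ->
  leb2.-integrable D (EFin \o (fun x => u x * w x)).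
Proof.
move=> p0 q0 pq /inLP[mu fu] /inLP[mw fw].
apply/integrableP; split; first exact/measurable_EFinP/measurable_funM.
have ru := (measurable_restrictT _ mD).1 mu.
have rw := (measurable_restrictT _ mD).1 mw.
have fin_u : normL D p%:E u \is a fin_num by rewrite ge0_fin_numE// normL_ge0.
apply: le_lt_trans (lte_mul_pinfty (normL_ge0 _ _) fin_u fw).
apply: le_trans (hoelder _ ru rw p0 q0 pq).
rewrite Lnorm1 [leLHS]integral_mkcond le_eqVlt; apply/orP; left; apply/eqP.
apply: eq_integral => x _; rewrite /= !patchE.
by case: ifPn => //= _; rewrite mul0r normr0.
Qed.

Lemma hoelder_ip p q u w : 0 < p -> 0 < q -> p^-1 + q^-1 = 1 ->
  inL D p%:E u -> inL D q%:E w ->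
  (`|ip D u w|%:E <= normL D p%:E u * normL D q%:E w)%E.
Proof.
move=> p0 q0 pq uL wL; have iuw := hoelder_integrable p0 q0 pq uL wL.
have [mu _] := (inLP _ _).1 uL; have [mw _] := (inLP _ _).1 wL.
have ru := (measurable_restrictT _ mD).1 mu.
have rw := (measurable_restrictT _ mD).1 mw.
apply: le_trans (hoelder _ ru rw p0 q0 pq).
rewrite /ip EFin_normr_Rintegral//.
apply: le_trans; first exact: le_abse_integral (measurable_int _ iuw).
rewrite Lnorm1 [leLHS]integral_mkcond le_eqVlt; apply/orP; left; apply/eqP.
apply: eq_integral => x _; rewrite /= !patchE.
by case: ifPn => //= _; rewrite mul0r normr0.
Qed.

Lemma hoelder_integrable_dot p q (v1 v2 : R * R -> R * R) :
  0 < p -> 0 < q -> p^-1 + q^-1 = 1 -> inLv D p%:E v1 -> inLv D q%:E v2 ->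
  leb2.-integrable D (EFin \o (fun x => dot (v1 x) (v2 x))).
Proof.
move=> p0 q0 pq [a1 a2] [b1 b2].
have := integrableD mD (hoelder_integrable p0 q0 pq a1 b1)
  (hoelder_integrable p0 q0 pq a2 b2).
by apply: eq_integrable => // x _; rewrite /= -EFinD.
Qed.

Lemma hoelder_ipv p q (v1 v2 : R * R -> R * R) :
  1 <= p -> 1 <= q -> p^-1 + q^-1 = 1 -> inLv D p%:E v1 -> inLv D q%:E v2 ->
  (`|ipv D v1 v2|%:E <= normLv D p%:E v1 * normLv D q%:E v2)%E.
Proof.
move=> p1 q1 pq v1L v2L.
have p0 : 0 < p by exact: lt_le_trans p1.
have q0 : 0 < q by exact: lt_le_trans q1.
have e1 := inL_enorm p1 v1L; have e2 := inL_enorm q1 v2L.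
apply: le_trans (hoelder_ip p0 q0 pq e1 e2).
have idot := hoelder_integrable_dot p0 q0 pq v1L v2L.
have ie := hoelder_integrable p0 q0 pq e1 e2.
rewrite lee_fin; apply: le_trans (le_normr_Rintegral mD idot) _.
apply: le_trans (ler_norm _); apply: le_Rintegral => //.
  exact: integrable_norm.
by move=> x _; exact: cauchy_schwarz.
Qed.

Hypothesis D_fin : (leb2 D < +oo)%E.

Lemma bounded_inL p u (C : R) : 0 < p -> mfun u ->
  {ae leb2, forall x, D x -> `|u x| <= C} -> inL D p%:E u.
Proof.
move=> p0 mu uC; apply/inLP; split=> //; rewrite /normL unlock poweR_lty//.
apply: (@le_lt_trans _ _ (\int[leb2]_(x in D) (`|C| `^ p)%:E)%E).
  rewrite [leRHS]integral_mkcond; apply: ge0_integral_le_null.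
  - by move=> x; exact: poweR_ge0.
  - by move=> x; rewrite patchE; case: ifP => // _; rewrite lee_fin powR_ge0.
  apply: filterS uC => x h; rewrite /= !patchE; case: ifPn => [/set_mem Dx|_].
    rewrite lee_fin ge0_ler_powR ?nnegrE ?(ltW p0)//.
    exact: le_trans (h Dx) (ler_norm _).
  by rewrite /= normr0 powR0// gt_eqF.
by rewrite integral_cst// lte_mul_pinfty// lee_fin powR_ge0.
Qed.

Lemma inL_integrable p u : 1 < p -> inL D p%:E u ->
  leb2.-integrable D (EFin \o u).
Proof.
move=> p1 uL; pose q := p / (p - 1).
have q0 : 0 < q by rewrite divr_gt0 ?subr_gt0// (lt_trans _ p1).
have pq : p^-1 + q^-1 = 1.
  by rewrite /q; field; rewrite subr_eq0 !gt_eqF// (lt_trans _ p1).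
have c1 : inL D q%:E (cst 1).
  by apply: (@bounded_inL _ _ 1) => //; apply: aeW => x _; rewrite normr1.
have p0 : 0 < p by rewrite (lt_trans _ p1).
have := hoelder_integrable p0 q0 pq uL c1.
by apply: eq_integrable => // x _; rewrite /= mulr1.
Qed.

Lemma bounded_mul_integrable u w (C : R) :
  leb2.-integrable D (EFin \o u) -> mfun w ->
  {ae leb2, forall x, D x -> `|w x| <= C} ->
  leb2.-integrable D (EFin \o (fun x => u x * w x)).
Proof.
move=> iu mw wC.
have mu := (measurable_EFinP _ _).1 (measurable_int _ iu).
apply: (@integrable_ae_le _ _ _ leb2 D (EFin \o (fun x => u x * w x)%R)
  (fun x : mplane R => C%:E * (EFin \o u) x)%E) => //.
- exact/measurable_EFinP/measurable_funM.
- apply: filterS wC => x h Dx; rewrite /= lee_fin !normrM mulrC.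
  by rewrite ler_wpM2r// (le_trans (h Dx)) ?ler_norm.
- exact: integrableZl.
Qed.

End lebesgue_spaces.

(** * Calculus of partial derivatives *)

Section partial_derivatives.
Context {R : realType}.
Implicit Types (u w : R * R -> R) (f : R -> R).

Lemma is_derive1_continuous f (df : R -> R) :
  (forall x, is_derive (x : R) 1 f (df x)) -> continuous f.
Proof.
move=> d x; apply: differentiable_continuous; apply/derivable1_diffP.
exact: ex_derive.
Qed.

Lemma is_derive_partial1 u (x y du : R) :
  is_derive x 1 (fun s => u (s, y)) du <-> is_derive ((x, y) : R * R) (1, 0) u du.
Proof.
have E : (fun h : R => h^-1 *: ((u \o shift (x, y)) (h *: (1, 0)) - u (x, y))) =
    (fun h : R => h^-1 *: (((fun s => u (s, y)) \o shift x) (h *: 1) - u (x, y))).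
  apply/funext => h; congr (_ *: (u _ - _)).
  by rewrite /shift/= [LHS]surjective_pairing/= scaler0 add0r.
by split=> -[d1 d2]; split; move: d1 d2; rewrite /derivable /derive /= E.
Qed.

Lemma is_derive_partial2 u (x y du : R) :
  is_derive y 1 (fun s => u (x, s)) du <-> is_derive ((x, y) : R * R) (0, 1) u du.
Proof.
have E : (fun h : R => h^-1 *: ((u \o shift (x, y)) (h *: (0, 1)) - u (x, y))) =
    (fun h : R => h^-1 *: (((fun s => u (x, s)) \o shift y) (h *: 1) - u (x, y))).
  apply/funext => h; congr (_ *: (u _ - _)).
  by rewrite /shift/= [LHS]surjective_pairing/= scaler0 add0r.
by split=> -[d1 d2]; split; move: d1 d2; rewrite /derivable /derive /= E.
Qed.

Lemma Ck_continuous n u : Ck n u -> continuous u.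
Proof. by case: n => [|n] []. Qed.

Lemma Ck_S n u : Ck n.+1 u ->
  [/\ forall x : R * R, is_derive x (1, 0) u ('D_(1, 0) u x),
      forall x : R * R, is_derive x (0, 1) u ('D_(0, 1) u x),
      Ck n (fun x => 'D_(1, 0) u x) & Ck n (fun x => 'D_(0, 1) u x)].
Proof.
by case=> _ [d c1 c2]; split=> // x; have [d1 d2] := d x; exact/derivableP.
Qed.

Lemma Ck_intro n u u1 u2 : continuous u ->
  (forall x : R * R, is_derive x (1, 0) u (u1 x)) ->
  (forall x : R * R, is_derive x (0, 1) u (u2 x)) ->
  Ck n u1 -> Ck n u2 -> Ck n.+1 u.
Proof.
move=> cu d1 d2 c1 c2; split=> //.
have -> : (fun x => 'D_(1, 0) u x) = u1 by apply/funext => x; rewrite derive_val.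
have -> : (fun x => 'D_(0, 1) u x) = u2 by apply/funext => x; rewrite derive_val.
by split=> // x; split; apply: ex_derive.
Qed.

Lemma CkW n u : Ck n.+1 u -> Ck n u.
Proof.
elim: n u => [|n ih] u; first by case.
move=> c; have [d1 d2 c1 c2] := Ck_S c.
by apply: (Ck_intro (Ck_continuous c) d1 d2); exact: ih.
Qed.

Lemma Ck_cst n (a : R) : Ck n (cst a).
Proof.
elim: n a => [|n ih] a; first by split=> //; exact: cst_continuous.
by apply: (@Ck_intro _ _ (cst 0) (cst 0)) => //; exact: cst_continuous.
Qed.

Lemma CkD n u w : Ck n u -> Ck n w -> Ck n (fun x => u x + w x).
Proof.
elim: n u w => [|n ih] u w cu cw.
  by split=> // x; apply: continuousD; exact: (@Ck_continuous 0).
have [du1 du2 cu1 cu2] := Ck_S cu; have [dw1 dw2 cw1 cw2] := Ck_S cw.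
have c : continuous (fun x => u x + w x).
  by move=> x; apply: continuousD; [exact: Ck_continuous cu x|exact: Ck_continuous cw x].
exact: (Ck_intro c (fun x => is_deriveD (du1 x) (dw1 x))
  (fun x => is_deriveD (du2 x) (dw2 x)) (ih _ _ cu1 cw1) (ih _ _ cu2 cw2)).
Qed.

Lemma CkM n u w : Ck n u -> Ck n w -> Ck n (fun x => u x * w x).
Proof.
elim: n u w => [|n ih] u w cu cw.
  by split=> // x; apply: continuousM; exact: (@Ck_continuous 0).
have [du1 du2 cu1 cu2] := Ck_S cu; have [dw1 dw2 cw1 cw2] := Ck_S cw.
have c : continuous (fun x => u x * w x).
  by move=> x; apply: continuousM; [exact: Ck_continuous cu x|exact: Ck_continuous cw x].
exact: (Ck_intro c (fun x => is_deriveM (du1 x) (dw1 x))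
  (fun x => is_deriveM (du2 x) (dw2 x))
  (CkD (ih _ _ (CkW cu) cw1) (ih _ _ (CkW cw) cu1))
  (CkD (ih _ _ (CkW cu) cw2) (ih _ _ (CkW cw) cu2))).
Qed.

Lemma is_derive_affine1 (a b c x y : R) :
  is_derive x 1 (fun s => a * s + b * y + c) a.
Proof. by apply: is_derive_eq; rewrite !addr0 /GRing.scale/= mulr1. Qed.

Lemma is_derive_affine2 (a b c x y : R) :
  is_derive y 1 (fun s => a * x + b * s + c) b.
Proof. by apply: is_derive_eq; rewrite add0r mul1r addr0 /GRing.scale/= mulr1. Qed.

Lemma continuous_affine (a b c : R) :
  continuous (fun x : R * R => a * x.1 + b * x.2 + c).
Proof.
move=> x; apply: cvgD; last exact: cvg_cst.
apply: cvgD; (apply: cvgM; first exact: cvg_cst).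
  exact: cvg_fst.
exact: cvg_snd.
Qed.

(** Composing with an affine function turns both partial derivatives into
    multiples of the one-dimensional derivative, so that smoothness in one
    variable suffices. *)
Lemma Ck_comp_affine (f : nat -> R -> R) (a b c : R) n k :
  (forall j (t : R), is_derive t 1 (f j) (f j.+1 t)) ->
  Ck n (fun x => f k (a * x.1 + b * x.2 + c)).
Proof.
move=> df.
have cf j : continuous (f j) by exact: is_derive1_continuous (df j).
have cfa j : continuous (fun x : R * R => f j (a * x.1 + b * x.2 + c)).
  by move=> x; apply: (@continuous_comp _ _ _
    (fun x : R * R => a * x.1 + b * x.2 + c)); [exact: continuous_affine|exact: cf].
elim: n k => [|n ih] k; first by split.
have d1 (z : R * R) : is_derive z (1, 0) (fun x => f k (a * x.1 + b * x.2 + c))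
    (a * f k.+1 (a * z.1 + b * z.2 + c)).
  case: z => x y; apply/is_derive_partial1 => /=.
  rewrite (mulrC _ (f k.+1 _)); exact: (is_derive1_comp (df k _) (is_derive_affine1 a b c x y)).
have d2 (z : R * R) : is_derive z (0, 1) (fun x => f k (a * x.1 + b * x.2 + c))
    (b * f k.+1 (a * z.1 + b * z.2 + c)).
  case: z => x y; apply/is_derive_partial2 => /=.
  rewrite (mulrC _ (f k.+1 _)); exact: (is_derive1_comp (df k _) (is_derive_affine2 a b c x y)).
exact: (Ck_intro (cfa k) d1 d2 (CkM (Ck_cst n a) (ih k.+1))
  (CkM (Ck_cst n b) (ih k.+1))).
Qed.

End partial_derivatives.

(** * A smooth step *)

Section bump_functions.
Context {R : realType}.
Implicit Types (P : {poly R}) (s t : R).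

(** The functions t |-> P(1/t) exp(-1/t), continued by 0 to the half-line
    t <= 0: a class that is stable under differentiation. *)
Definition flat_exp P t : R := if 0 < t then P.[t^-1] * expR (- t^-1) else 0.

Lemma flat_exp_le0 P t : t <= 0 -> flat_exp P t = 0.
Proof. by rewrite /flat_exp ltNge => ->. Qed.

(** exp(s) dominates every power of s = 1/t. Applied to X P, the bound says that
    the difference quotients of flat_exp P at 0 tend to 0. *)
Lemma flat_exp_linear_bound P : exists2 C, 0 <= C &
  forall t, `|flat_exp P t| <= C * `|t|.
Proof.
exists (\sum_(i < size P) `|P`_i| * (i.+1)`!%:R) => [|t].
  by apply: sumr_ge0 => i _; rewrite mulr_ge0.
rewrite /flat_exp; case: ifPn => [t0|_]; last first.
  by rewrite normr0 mulr_ge0// sumr_ge0// => i _; rewrite mulr_ge0.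
rewrite horner_coef mulr_suml (le_trans (ler_norm_sum _ _ _))// mulr_suml.
apply: ler_sum => i _.
have s0 : 0 < t^-1 by rewrite invr_gt0.
rewrite !normrM -!mulrA ler_wpM2l// (ger0_norm (expR_ge0 _)) (gtr0_norm t0).
rewrite normrX (gtr0_norm s0) -ler_pdivrMr// -mulrA mulrCA -exprSr mulrC expRN.
rewrite ler_pdivrMr ?expR_gt0//.
have := expR_ge1Dxn i (ltW s0).
have f0 : 0 < (i.+1)`!%:R :> R by rewrite ltr0n fact_gt0.
move=> /(le_trans _) h; have : t^-1 ^+ i.+1 / (i.+1)`!%:R <= expR t^-1.
  by apply: h; rewrite lerDr.
by rewrite ler_pdivrMr// mulrC.
Qed.

Lemma is_derive_flat_exp P t :
  is_derive t 1 (flat_exp P) (flat_exp ('X^2 * (P - P^`())) t).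
Proof.
have [t0|t0|->] := ltgtP t 0.
- rewrite (flat_exp_le0 _ (ltW t0)).
  apply: (@near_eq_is_derive _ _ _ (cst (0 : R))) => /=.
  by near=> s; rewrite flat_exp_le0//; apply: ltW; near: s; exact: lt_nbhsl.
- apply: (@near_eq_is_derive _ _ _ (fun s => P.[s^-1] * expR (- s^-1))).
    near=> s; rewrite /flat_exp ifT//; near: s; exact: lt_nbhsr.
  have d : is_derive t 1 (fun s : R => s^-1) (- t ^- 2).
    apply: is_derive_eq; first by apply: is_deriveV; rewrite gt_eqF.
    by rewrite /GRing.scale/= mulr1.
  have dP := is_derive1_comp (is_derive_poly P t^-1) d.
  have de := @is_derive1_comp R expR (fun s => - s^-1) t _ _
    (is_derive_expR (- t^-1)) (is_deriveN d).
  apply: (is_derive_eq (is_deriveM dP de)).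
  rewrite /flat_exp t0 !hornerE /GRing.scale/= -exprVn; ring.
rewrite flat_exp_le0//.
(* The difference quotient at 0 is flat_exp ('X * P) h. *)
have [C C0 hC] := flat_exp_linear_bound ('X * P).
have hcvg : h^-1 *: ((flat_exp P \o shift 0) (h *: 1) - flat_exp P 0) @[h --> 0^'] --> 0.
  have c : C * `|h : R| @[h --> (0 : R)^'] --> (0 : R).
    have : C * `|h : R| @[h --> (0 : R)^'] --> C * `|0 : R|; last by rewrite normr0 mulr0.
    by apply: cvgMl_tmp; apply: cvg_norm; exact: cvg_within.
  apply: norm_cvg0; apply: (squeeze_cvgr _ (cvg_cst 0) c); near=> h.
  rewrite normr_ge0/= (flat_exp_le0 _ (lexx 0)) subr0 /shift/= addr0.
  apply: le_trans (hC h); rewrite /GRing.scale/= mulr1 /flat_exp.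
  case: ifPn => h0; last by rewrite mulr0.
  by rewrite hornerM hornerX mulrA.
by apply: DeriveDef; [exact: cvgP hcvg|exact: cvg_lim hcvg].
Unshelve. all: by end_near. Qed.

(** The polynomial of the k-th derivative of exp(-1/t). *)
Fixpoint flat_poly k : {poly R} :=
  if k is j.+1 then 'X^2 * (flat_poly j - (flat_poly j)^`()) else 1.

Lemma is_derive_flat_poly k t :
  is_derive t 1 (flat_exp (flat_poly k)) (flat_exp (flat_poly k.+1) t).
Proof. exact: is_derive_flat_exp. Qed.

(** The smooth function exp(-1/t), chosen because its rescalings
    smooth_step (n t - 1) vanish for t <= 1/n and tend to 1 for each t > 0. *)
Definition smooth_step t : R := flat_exp 1 t.

Lemma smooth_step_le0 t : t <= 0 -> smooth_step t = 0.
Proof. exact: flat_exp_le0. Qed.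

Lemma smooth_step_bounds t : 0 <= smooth_step t <= 1.
Proof.
rewrite /smooth_step /flat_exp; case: ifPn => [t0|_]; last by rewrite lexx ler01.
by rewrite hornerC mul1r expR_ge0 -expR0 ler_expR oppr_le0 invr_ge0 ltW.
Qed.

Lemma smooth_step_cvg t : 0 < t -> smooth_step (n%:R * t - 1) @[n --> \oo] --> (1 : R).
Proof.
move=> t0.
have large A : \forall n \near \oo, A <= n%:R * t - 1.
  near=> n; rewrite lerBrDr -ler_pdivrMr//; near: n; exact: nbhs_infty_ger.
have cy : n%:R * t - 1 @[n --> \oo] --> +oo by apply/cvgryPge.
have pos : \forall n \near \oo, 0 < n%:R * t - 1.
  by near=> n; apply: (@lt_le_trans _ _ 1) => //; near: n; exact: large.
have c : expR (- (n%:R * t - 1)^-1) @[n --> \oo] --> (1 : R).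
  have : expR (- (n%:R * t - 1)^-1) @[n --> \oo] --> expR (- 0);
    last by rewrite oppr0 expR0.
  apply: continuous_cvg; first exact: continuous_expR.
  by apply: cvgN; apply: ((gtr0_cvgV0 pos).2 cy).
apply: cvg_trans c; apply: near_eq_cvg; near=> n.
rewrite /smooth_step /flat_exp ifT; last by near: n.
by rewrite hornerC mul1r.
Unshelve. all: by end_near. Qed.

End bump_functions.

(** * Integrals of derivatives along lines *)

Section line_integrals.
Context {R : realType}.
Implicit Types (G g : R -> R).
Local Notation mu := (@lebesgue_measure R).

Lemma integral_derivative G g (a b : R) : a <= b ->
  (forall x, is_derive (x : R) 1 G (g x)) -> continuous g ->
  (\int[mu]_(x in `[a, b]) (g x)%:E = (G b - G a)%:E)%E.
Proof.
move=> + dG cg; rewrite le_eqVlt => /predU1P[<-|ab].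
  by rewrite set_itv1 integral_set1 subrr.
have cG : continuous G := is_derive1_continuous dG.
rewrite (@continuous_FTC2 _ g G)//.
- exact: continuous_subspaceT.
- split; first by move=> x _; exact: ex_derive.
    by apply: cvg_at_right_filter; apply: cG.
  by apply: cvg_at_left_filter; apply: cG.
- by move=> x _; rewrite derive1E derive_val.
Qed.

Let integral_itv_of g (M : R) : (forall x : R, M <= `|x| -> g x = 0) ->
  (\int[mu]_x (g x)%:E = \int[mu]_(x in `[(- M)%R, M]) (g x)%:E)%E.
Proof.
move=> g0; rewrite [RHS]integral_mkcond; apply: eq_integral => x _.
rewrite patchE; case: ifPn => //.
rewrite notin_setE/= in_itv/= => /negP; rewrite -ler_norml -ltNge => /ltW Mx.
by rewrite g0.
Qed.

Lemma integral_line_derivative G g (M : R) : 0 < M ->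
  (forall x, is_derive (x : R) 1 G (g x)) -> continuous g ->
  (forall x : R, M <= `|x| -> G x = 0) -> (forall x : R, M <= `|x| -> g x = 0) ->
  (\int[mu]_x (g x)%:E = 0)%E.
Proof.
move=> M0 dG cg G0 g0; rewrite (integral_itv_of g0) (integral_derivative _ dG)//.
  by rewrite !G0 ?subrr ?normrN// ler_norm.
by rewrite ge0_cp// ltW.
Qed.

(** Each of the two half-lines that end at c contributes - G c, as the sign changes
    together with the orientation of the end point. *)
Lemma integral_line_sg_derivative G g (M c : R) : `|c| < M ->
  (forall x, is_derive (x : R) 1 G (g x)) -> continuous g ->
  (forall x : R, M <= `|x| -> G x = 0) -> (forall x : R, M <= `|x| -> g x = 0) ->
  (\int[mu]_x (Num.sg (x - c) * g x)%:E = (- 2 * G c)%:E)%E.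
Proof.
move=> cM dG cg G0 g0; have /andP[c1 c2] : - M < c < M by rewrite -ltr_norml.
have M0 : 0 < M by exact: le_lt_trans cM.
rewrite (@ae_ext_integral _ _ _ mu _ _
    (((EFin \o g) \_ `[c, M]) \- ((EFin \o g) \_ `[(- M)%R, c]))%E); last first.
  exists [set c]; split => //; first exact: lebesgue_measure_set1.
  move=> x /=; apply: contra_notP => xc _; rewrite /= !patchE !mem_setE.
  rewrite !in_itv/=.
  have [cx|xc'|] := ltgtP c x; last by move=> ec; case: xc.
    rewrite andbF sube0 gtr0_sg ?subr_gt0// mul1r; case: ifPn => //.
    by rewrite -ltNge => Mx; rewrite g0// (le_trans (ltW Mx))// ler_norm.
  rewrite andbT sub0e ltr0_sg ?subr_lt0// mulN1r; case: ifPn => //.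
  rewrite -ltNge => Mx; have xM : M <= `|x|.
    by rewrite -normrN (le_trans _ (ler_norm _))// lerNr ltW.
  by rewrite g0// oppr0.
have ig a b : mu.-integrable `[a, b] (EFin \o g).
  apply: continuous_compact_integrable; first exact: segment_compact.
  exact: continuous_subspaceT.
have igT a b : mu.-integrable setT ((EFin \o g) \_ `[a, b]).
  by rewrite -integrable_mkcond//; exact: measurable_itv.
rewrite integralB//.
rewrite -!integral_mkcond/=.
rewrite (integral_derivative (ltW c2) dG)// (integral_derivative (ltW c1) dG)//.
rewrite -EFinB (G0 M) ?ler_norm// (G0 (- M)) ?normrN ?ler_norm//; congr EFin; ring.
Qed.

End line_integrals.

(** * Functions with compact support *)

Section compact_support.
Context {R : realType}.
Implicit Types (u : R * R -> R) (K : set (R * R)).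

Lemma derive_outside_support K u (v x : R * R) : closed K ->
  (forall x, ~ K x -> u x = 0) -> ~ K x -> 'D_v u x = 0.
Proof.
move=> cK u0 nKx; rewrite (@near_eq_derive _ _ _ _ (cst 0)) ?derive_cst//.
have : nbhs x (~` K) by apply: open_nbhs_nbhs; split => //; exact: closed_openC.
by apply: filterS => y /u0.
Qed.

Lemma compact_in_box K (m : R) : compact K ->
  exists2 M, m < M & forall x, K x -> `|x.1| < M /\ `|x.2| < M.
Proof.
move=> /compact_bounded[M0 [_ KM]].
exists (Num.max (`|M0| + 2) (m + 1)) => [|x Kx].
  by rewrite lt_max [X in _ || X]ltrDl ltr01 orbT.
have : `|x| <= `|M0| + 1 by apply: KM => //; rewrite ltr_pwDr// ler_norm.
rewrite prod_normE ge_max => /andP[h1 h2].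
by rewrite !lt_max; split; apply/orP; left; lra.
Qed.

Lemma compact_support_bounded K u : compact K -> continuous u ->
  (forall x, ~ K x -> u x = 0) -> exists2 C, 0 <= C & forall x, `|u x| <= C.
Proof.
move=> cK cu u0.
have /compact_bounded[M [_ uM]] : compact (u @` K).
  by apply: continuous_compact => //; exact: continuous_subspaceT.
exists (`|M| + 1) => [|x]; first by rewrite addr_ge0.
have [Kx|/u0 ->] := pselect (K x); last by rewrite normr0 addr_ge0.
by apply: (uM (`|M| + 1)); [rewrite ltr_pwDr// ler_norm|exists x].
Qed.

Lemma leb2_box_fin (M : R) : (leb2 (`[(- M)%R, M] `*` `[(- M)%R, M] : set (mplane R)) < +oo)%E.
Proof.
have mI : measurable (`[- M, M] : set (measurableTypeR R)) by exact: measurable_itv.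
have := product_measure1E (@lebesgue_measure R) (@lebesgue_measure R) mI mI.
move=> E; rewrite [ltLHS]E.
have lI : (lebesgue_measure (`[(- M)%R, M] : set R) < +oo)%E.
  by rewrite lebesgue_measure_itv/=; case: ifP; rewrite ?ltry// -EFinD ltry.
by apply: lte_mul_pinfty => //; rewrite ge0_fin_numE.
Qed.

Lemma integrable_box (F : R * R -> R) (M C : R) :
  measurable_fun setT (F : mplane R -> R) -> (forall x, `|F x| <= C) ->
  (forall x, M <= `|x.1| \/ M <= `|x.2| -> F x = 0) ->
  leb2.-integrable setT (EFin \o F).
Proof.
move=> mF FC F0; pose B : set (mplane R) := `[- M, M] `*` `[- M, M].
have mB : measurable B by apply: measurableX; exact: measurable_itv.
have -> : EFin \o F = (EFin \o F) \_ B.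
  apply/funext => x; rewrite patchE; case: ifPn => //.
  rewrite notin_setE => /not_andP nB; rewrite /= F0//; case: nB => /=;
    rewrite in_itv/= -ler_norml => /negP; rewrite -ltNge => /ltW Mx; [by left|by right].
rewrite -integrable_mkcond//; apply: measurable_bounded_integrable => //.
- exact: leb2_box_fin.
- exact: measurable_funTS.
by exists C; split; rewrite ?num_real// => D /ltW CD x _; exact: le_trans CD.
Qed.

Lemma integrable_itv_support (F : R -> R) (M : R) : continuous F ->
  (forall x : R, M <= `|x| -> F x = 0) ->
  lebesgue_measure.-integrable setT (EFin \o F).
Proof.
move=> cF F0; have -> : EFin \o F = (EFin \o F) \_ `[- M, M].
  apply/funext => x; rewrite patchE; case: ifPn => //.
  rewrite notin_setE/= !in_itv/= -!ler_norml => /negP.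
  by rewrite -ltNge => /ltW /F0 ->.
rewrite -integrable_mkcond; last exact: measurable_itv.
apply: continuous_compact_integrable; first exact: segment_compact.
exact: continuous_subspaceT.
Qed.

Lemma continuous_section1 u (y : R) : continuous u -> continuous (fun x => u (x, y)).
Proof.
move=> cu x; apply: (@continuous_comp _ _ _ (fun x => (x, y))); last exact: cu.
exact: (cvg_pair cvg_id (cvg_cst y)).
Qed.

Lemma continuous_section2 u (x : R) : continuous u -> continuous (fun y => u (x, y)).
Proof.
move=> cu y; apply: (@continuous_comp _ _ _ (fun y => (x, y))); last exact: cu.
exact: (cvg_pair (cvg_cst x) cvg_id).
Qed.

Lemma integrable_compact_support K u : compact K -> continuous u ->
  (forall x, ~ K x -> u x = 0) -> leb2.-integrable setT (EFin \o u).
Proof.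
move=> cK cu u0; have [C _ uC] := compact_support_bounded cK cu u0.
have [M _ KM] := compact_in_box 0 cK.
apply: (@integrable_box _ M C) => //; first exact: continuous_measurable_plane.
move=> x h; apply: u0 => /KM[h1 h2].
by case: h; rewrite leNgt ?h1 ?h2.
Qed.

(** By Fubini: the integral along each line parallel to the derivative vanishes. *)
Lemma integral_partial K u : compact K -> Ck 1 u -> (forall x, ~ K x -> u x = 0) ->
  (\int[leb2]_x ('D_(1, 0) u x)%:E = 0 /\ \int[leb2]_x ('D_(0, 1) u x)%:E = 0)%E.
Proof.
move=> cK cu u0; have [d1 d2 /Ck_continuous c1 /Ck_continuous c2] := Ck_S cu.
have [M M0 KM] := compact_in_box 0 cK.
have clK : closed K by apply: compact_closed => //; exact: norm_hausdorff.
have du0 v x : ~ K x -> 'D_v u x = 0 by exact: derive_outside_support.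
have out x : M <= `|x.1| \/ M <= `|x.2| -> ~ K x.
  by move=> h /KM[h1 h2]; case: h; rewrite leNgt ?h1 ?h2.
split.
  rewrite -(@integral21_prod_meas1 _ _ _ _ _ lebesgue_measure lebesgue_measure); last first.
    exact: integrable_compact_support (du0 _).
  rewrite -[RHS](integral0 lebesgue_measure setT); apply: eq_integral => y _.
  apply: (@integral_line_derivative _ (fun x => u (x, y)) _ M) => //.
  - by move=> x; exact/is_derive_partial1.
  - exact: (@continuous_section1 (fun z => 'D_(1, 0) u z)) c1.
  - by move=> x Mx; apply/u0/out; left.
  - by move=> x Mx; apply/du0/out; left.
rewrite -(@integral12_prod_meas1 _ _ _ _ _ lebesgue_measure lebesgue_measure); last first.
  exact: integrable_compact_support (du0 _).
rewrite -[RHS](integral0 lebesgue_measure setT); apply: eq_integral => x _.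
apply: (@integral_line_derivative _ (fun y => u (x, y)) _ M) => //.
- by move=> y; exact/is_derive_partial2.
- exact: (@continuous_section2 (fun z => 'D_(0, 1) u z)) c2.
- by move=> y My; apply/u0/out; right.
- by move=> y My; apply/du0/out; right.
Qed.

End compact_support.

(** * Symmetry of second derivatives *)

Section symmetric_derivatives.
Context {R : realType}.

Let mvt (f df : R -> R) (a h : R) : 0 < h ->
  (forall x, is_derive (x : R) 1 f (df x)) ->
  exists2 c, a < c < a + h & f (a + h) - f a = df c * h.
Proof.
move=> h0 d; have ah : a < a + h by rewrite ltrDl.
have cf := is_derive1_continuous d.
have [c] := MVT ah (fun x _ => d x) (continuous_subspaceT cf).
by rewrite in_itv/= => ac ->; exists c => //; congr (_ * _); ring.
Qed.

Let dist_lt (a b h : R) : a < b < a + h -> `|b - a| < h.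
Proof. by move=> ab; rewrite ltr_norml; lra. Qed.

Let second_difference (p q r s d e F G h : R) : 0 < h ->
  p - q - (r - s) = d * h -> d = G * h ->
  p - r - (q - s) = e * h -> e = F * h -> F = G.
Proof.
move=> h0 E1 Ed E2 Ee; have hh : h * h != 0 by rewrite mulf_neq0 ?gt_eqF.
by apply: (mulIf hh); rewrite !mulrA -Ed -Ee -E1 -E2; ring.
Qed.

Let close_values (p q a b e : R) :
  `|p - a| < e / 2 -> `|q - b| < e / 2 -> p = q -> `|a - b| <= e.
Proof. by move=> + + pq; rewrite pq !ltr_norml ler_norml => *; lra. Qed.

(** Both mixed derivatives are limits of the second differences over shrinking
    squares. *)
Lemma mixed_derivatives_commute (u : R * R -> R) (z : R * R) : Ck 2 u ->
  'D_(1, 0) (fun x => 'D_(0, 1) u x) z = 'D_(0, 1) (fun x => 'D_(1, 0) u x) z.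
Proof.
move=> cu; have [d1 d2 cu1 cu2] := Ck_S cu.
have [d11 d12 c11 c12] := Ck_S cu1; have [d21 d22 c21 c22] := Ck_S cu2.
pose f (x : R * R) := 'D_(1, 0) (fun x => 'D_(0, 1) u x) x.
pose g (x : R * R) := 'D_(0, 1) (fun x => 'D_(1, 0) u x) x.
rewrite -[LHS]/(f z) -[RHS]/(g z).
case: z => x y; apply/eqP; rewrite -subr_eq0 -normr_le0; apply/ler_addgt0Pl => e e0.
rewrite addr0.
(* The second difference of u over a small square is both a value of f and a
   value of g, multiplied by the area. *)
have key h : 0 < h -> exists p q : R * R,
    [/\ `|p.1 - x| < h, `|p.2 - y| < h, `|q.1 - x| < h, `|q.2 - y| < h & f p = g q].
  move=> h0.
  have [a xa Ea] := @mvt (fun s => u (s, y + h) - u (s, y)) _ x h h0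
    (fun s => is_deriveB ((is_derive_partial1 _ _ _ _).2 (d1 (s, y + h)))
      ((is_derive_partial1 _ _ _ _).2 (d1 (s, y)))).
  have [b yb Eb] := @mvt (fun s => 'D_(1, 0) u (a, s)) _ y h h0
    (fun s => (is_derive_partial2 _ _ _ _).2 (d12 (a, s))).
  have [b' yb' Eb'] := @mvt (fun s => u (x + h, s) - u (x, s)) _ y h h0
    (fun s => is_deriveB ((is_derive_partial2 _ _ _ _).2 (d2 (x + h, s)))
      ((is_derive_partial2 _ _ _ _).2 (d2 (x, s)))).
  have [a' xa' Ea'] := @mvt (fun s => 'D_(0, 1) u (s, b')) _ x h h0
    (fun s => (is_derive_partial1 _ _ _ _).2 (d21 (s, b'))).
  exists (a', b'), (a, b).
  split; [exact: dist_lt..|].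
  exact: (second_difference h0 Ea Eb Eb' Ea').
have near_at (w : R * R -> R) : continuous w ->
    exists2 h, 0 < h & forall p, `|p.1 - x| < h -> `|p.2 - y| < h ->
      `|w p - w (x, y)| < e / 2.
  move=> cw; have /cvgrPdist_lt/(_ (e / 2) (divr_gt0 e0 (ltr0n _ 2))) := cw (x, y).
  case=> -[U1 U2] /= [/nbhs_ballP[r1 /= r10 U1r] /nbhs_ballP[r2 /= r20 U2r]] H.
  exists (Num.min r1 r2) => [|p p1 p2]; first by rewrite lt_min r10.
  rewrite distrC; apply: H; split; [apply: U1r|apply: U2r]; rewrite /ball/= distrC.
    by apply: lt_le_trans p1 _; rewrite ge_min lexx.
  by apply: lt_le_trans p2 _; rewrite ge_min lexx orbT.
have [h1 h10 H1] := near_at f (Ck_continuous c21).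
have [h2 h20 H2] := near_at g (Ck_continuous c12).
have [p [q [p1 p2 q1 q2 fg]]] := key (Num.min h1 h2) ltac:(by rewrite lt_min h10).
move: p1 p2 q1 q2; rewrite !lt_min => /andP[p1 _] /andP[p2 _] /andP[_ q1] /andP[_ q2].
exact: close_values (H1 p p1 p2) (H2 q q1 q2) fg.
Qed.

End symmetric_derivatives.

(** * The divergence of the singular field *)

Section fundamental_solution.
Context {R : realType}.
Local Notation mu := (@lebesgue_measure R).

(** For t = Y / X, the angles from the two axes add up to a function that is constant
    on each quadrant and jumps across the axes; the jumps carry the point mass. *)
Lemma atan_inv (t : R) : t != 0 -> atan t + atan t^-1 = Num.sg t * (pi / 2).
Proof.
have pos (s : R) : 0 < s -> atan s + atan s^-1 = pi / 2.
  move=> s0; have a0 : 0 < atan s by rewrite -atan0; exact: lt_atan.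
  have a1 := atan_ltpi2 s.
  have p0 := @pi_gt0 R.
  suff -> : s^-1 = tan (pi / 2 - atan s).
    by rewrite tanK ?in_itv/=; [ring|lra].
  have <- : (tan (atan s))^-1 = s^-1 by rewrite atanK.
  rewrite /tan invf_div; congr (_ / _).
    by rewrite -opprB sinN sinBpihalf opprK.
  by rewrite -opprB cosN cosBpihalf.
have [t0|t0|->] := ltgtP t 0; last by [].
  move=> _; rewrite ltr0_sg// mulN1r.
  by rewrite -(pos (- t)) ?oppr_gt0// invrN !atanN; ring.
by move=> _; rewrite gtr0_sg// mul1r pos.
Qed.

Lemma norm_atan_le (t : R) : `|atan t| <= pi / 2.
Proof. by rewrite ler_norml !ltW ?atan_ltpi2 ?atan_gtNpi2. Qed.

(** The weight a / (a^2 + (y - c)^2) is the derivative of atan ((y - c) / a). *)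
Lemma integral_atan_by_parts (f df : R -> R) (a c M : R) : a != 0 -> 0 < M ->
  (forall y, is_derive (y : R) 1 f (df y)) -> continuous df ->
  (forall y, M <= `|y| -> f y = 0) -> (forall y, M <= `|y| -> df y = 0) ->
  (\int[mu]_y (a / (a ^+ 2 + (y - c) ^+ 2) * f y)%:E =
   \int[mu]_y (- (atan ((y - c) / a) * df y))%:E)%E.
Proof.
move=> a0 M0 d cdf f0 df0.
have r0 y : a ^+ 2 + (y - c) ^+ 2 != 0.
  have : 0 < a ^+ 2 by rewrite exprn_even_gt0.
  by have := sqr_ge0 (y - c); lra.
have dq y : is_derive (y : R) 1 (fun y => (y - c) / a) a^-1.
  have := is_derive_affine1 a^-1 0 (- (c / a)) y 0.
  rewrite (_ : (fun s => _) = (fun y => (y - c) / a))//.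
  by apply/funext => s; ring.
have da y : is_derive (y : R) 1 (fun y => atan ((y - c) / a))
    (a / (a ^+ 2 + (y - c) ^+ 2)).
  have := @is_derive1_comp R atan (fun y => (y - c) / a) y _ _
    (is_derive1_atan ((y - c) / a)) (dq y).
  by move=> d'; apply: (is_derive_eq d'); field; rewrite a0 r0.
have cf := is_derive1_continuous d; have ca := is_derive1_continuous da.
have cr : continuous (fun y => a / (a ^+ 2 + (y - c) ^+ 2)).
  move=> y; apply: cvgM; first exact: cvg_cst.
  apply: cvgV; first exact: r0.
  apply: cvgD; first exact: cvg_cst.
  by rewrite expr2; apply: cvgM; apply: cvgB => //; exact: cvg_cst.
have c1 : continuous (fun y => a / (a ^+ 2 + (y - c) ^+ 2) * f y).
  by move=> y; apply: cvgM; [exact: cr|exact: cf].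
have c2 : continuous (fun y => atan ((y - c) / a) * df y).
  by move=> y; apply: cvgM; [exact: ca|exact: cdf].
have s1 y : M <= `|y| -> a / (a ^+ 2 + (y - c) ^+ 2) * f y = 0.
  by move=> /f0 ->; rewrite mulr0.
have s2 y : M <= `|y| -> atan ((y - c) / a) * df y = 0.
  by move=> /df0 ->; rewrite mulr0.
have i1 := integrable_itv_support c1 s1; have i2 := integrable_itv_support c2 s2.
have E : (\int[mu]_y (atan ((y - c) / a) * df y +
    a / (a ^+ 2 + (y - c) ^+ 2) * f y)%:E = 0)%E.
  apply: (@integral_line_derivative _ (fun y => atan ((y - c) / a) * f y) _ M) => //.
  - move=> y; have := is_deriveM (da y) (d y).
    by move=> d'; apply: (is_derive_eq d'); rewrite /GRing.scale/= [f y * _]mulrC.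
  - by move=> y; apply: cvgD; [exact: c2|exact: c1].
  - by move=> y /f0 ->; rewrite mulr0.
  - by move=> y My; rewrite s1// s2// addr0.
transitivity (\int[mu]_y (((atan ((y - c) / a) * df y +
    a / (a ^+ 2 + (y - c) ^+ 2) * f y)%:E) - (atan ((y - c) / a) * df y)%:E)%E)%E.
  by apply: eq_integral => y _; rewrite -EFinB addrAC subrr add0r.
transitivity (\int[mu]_y (0 - (atan ((y - c) / a) * df y)%:E)%E)%E; last first.
  by apply: eq_integral => y _; rewrite sub0e.
rewrite integralB//; last exact: (integrableD measurableT i2 i1).
rewrite integralB//; last exact: integrable0.
by rewrite [X in (X - _ = _)%E]E integral0.
Qed.

End fundamental_solution.

Section point_source.
Context {R : realType}.
Local Notation mu := (@lebesgue_measure R).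

Lemma leb2_vertical (a : R) : leb2 ([set a] `*` setT : set (mplane R)) = 0%E.
Proof.
rewrite [LHS](product_measure1E (@lebesgue_measure R) (@lebesgue_measure R))//.
by rewrite [X in (X * _)%E]lebesgue_measure_set1 mul0e.
Qed.

Lemma leb2_horizontal (a : R) : leb2 (setT `*` [set a] : set (mplane R)) = 0%E.
Proof.
rewrite [LHS](product_measure1E (@lebesgue_measure R) (@lebesgue_measure R))//.
by rewrite [X in (_ * X)%E]lebesgue_measure_set1 mule0.
Qed.

Variables (phi : R * R -> R) (K : set (R * R)) (c : R * R).
Hypotheses (sphi : Ck 2 phi) (cK : compact K) (phi0 : forall x, ~ K x -> phi x = 0).

Let D1 (x : R * R) : R := 'D_(1, 0) phi x.
Let D2 (x : R * R) : R := 'D_(0, 1) phi x.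
Let J (x : R * R) : R := 'D_(0, 1) (fun x => 'D_(1, 0) phi x) x.
Let X (x : R * R) : R := x.1 - c.1.
Let Y (x : R * R) : R := x.2 - c.2.

Let dphi1 (x : R * R) : is_derive x (1, 0) phi (D1 x).
Proof. by have [d _ _ _] := Ck_S sphi; exact: d. Qed.

Let cD1 : Ck 1 D1.
Proof. by have [_ _ d _] := Ck_S sphi. Qed.

Let cD2 : Ck 1 D2.
Proof. by have [_ _ _ d] := Ck_S sphi. Qed.

Let dD1 (x : R * R) : is_derive x (0, 1) D1 (J x).
Proof. by have [_ d _ _] := Ck_S cD1; exact: d. Qed.

Let dD2 (x : R * R) : is_derive x (1, 0) D2 (J x).
Proof.
have [d _ _ _] := Ck_S cD2; by rewrite /J -mixed_derivatives_commute.
Qed.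

Let cJ : continuous J.
Proof. by have [_ _ _ d] := Ck_S cD1; exact: Ck_continuous d. Qed.

Let clK : closed K.
Proof. by apply: compact_closed => //; exact: norm_hausdorff. Qed.

Let D10 x : ~ K x -> D1 x = 0.
Proof. exact: derive_outside_support. Qed.

Let D20 x : ~ K x -> D2 x = 0.
Proof. exact: derive_outside_support. Qed.

Let J0 x : ~ K x -> J x = 0.
Proof. by apply: derive_outside_support => // y; exact: D10. Qed.

Let A1 (x : R * R) : R := - (atan (Y x / X x) * J x).
Let A2 (x : R * R) : R := - (atan (X x / Y x) * J x).
Let S (x : R * R) : R := Num.sg (Y x) * (- (pi / 2) * Num.sg (X x) * J x).

Let mX : measurable_fun setT (X : mplane R -> R).
Proof. by apply: measurable_funB. Qed.

Let mY : measurable_fun setT (Y : mplane R -> R).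
Proof. by apply: measurable_funB. Qed.

Let mJ : measurable_fun setT (J : mplane R -> R).
Proof. exact: continuous_measurable_plane. Qed.

Let measurable_atan_quotient (u v : mplane R -> R) : measurable_fun setT u ->
  measurable_fun setT v -> measurable_fun setT (fun x => - (atan (u x / v x) * J x)).
Proof.
move=> mu_ mv; apply: measurableT_comp => //; apply: measurable_funM => //.
apply: (@measurableT_comp _ _ _ _ _ _ (@atan R) _ (fun x => u x / v x)).
  by apply: continuous_measurable_fun => t; exact: continuous_atan.
by apply: measurable_funM => //; exact: (measurableT_comp measurable_inv mv).
Qed.

Let measurable_sg : measurable_fun setT (@Num.sg R).
Proof.
rewrite (_ : @Num.sg R = fun t => if t == 0 then 0 else if t < 0 then -1 else 1)//.
apply: measurable_fun_ifT => //; first exact: measurable_fun_eqr.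
by apply: measurable_fun_ifT => //; exact: measurable_fun_ltr.
Qed.

(** The vector field (X, Y)/(X^2 + Y^2) has divergence 2 pi times the point mass at its
    centre. Integrating the first component by parts in the second variable (its
    primitive is atan (Y/X)) and the second component in the first variable (with
    primitive atan (X/Y)) puts the same mixed derivative J of phi into both
    integrals, now with bounded coefficients. The coefficients add up to
    - (pi/2) sg X sg Y, and the integral of sg X sg Y J is 4 phi(c). No limit near
    the singularity is taken: on almost every line the integrand is smooth. *)
Lemma integral_point_source :
  leb2.-integrable setT (EFin \o (fun x => X x / (X x ^+ 2 + Y x ^+ 2) * D1 x)) ->
  leb2.-integrable setT (EFin \o (fun x => Y x / (Y x ^+ 2 + X x ^+ 2) * D2 x)) ->
  (\int[leb2]_x (X x / (X x ^+ 2 + Y x ^+ 2) * D1 x +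
                 Y x / (Y x ^+ 2 + X x ^+ 2) * D2 x)%:E = (- (2 * pi) * phi c)%:E)%E.
Proof.
move=> iT1 iT2.
have [M0 cM KM0] := compact_in_box (`|c.1| + `|c.2|) cK.
have M00 : 0 < M0 by apply: le_lt_trans cM; rewrite addr_ge0.
have out x : M0 <= `|x.1| \/ M0 <= `|x.2| -> ~ K x.
  by move=> h /KM0[h1 h2]; case: h; rewrite leNgt ?h1 ?h2.
have [C C0 JC] := compact_support_bounded cK cJ J0.
have bound (t : R) x : `|t| <= pi / 2 -> `|t * J x| <= pi / 2 * C.
  by move=> ht; rewrite normrM ler_pM.
have iA1 : leb2.-integrable setT (EFin \o A1).
  apply: (@integrable_box _ _ M0 (pi / 2 * C)).
  - exact: measurable_atan_quotient.
  - by move=> x; rewrite normrN bound// norm_atan_le.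
  - by move=> x /out/J0 h; rewrite /A1 h mulr0 oppr0.
have iA2 : leb2.-integrable setT (EFin \o A2).
  apply: (@integrable_box _ _ M0 (pi / 2 * C)).
  - exact: measurable_atan_quotient.
  - by move=> x; rewrite normrN bound// norm_atan_le.
  - by move=> x /out/J0 h; rewrite /A2 h mulr0 oppr0.
have iS : leb2.-integrable setT (EFin \o S).
  apply: (@integrable_box _ _ M0 (pi / 2 * C)).
  - apply: measurable_funM; first exact: (measurableT_comp measurable_sg mY).
    apply: measurable_funM => //; apply: measurable_funM => //.
    exact: (measurableT_comp measurable_sg mX).
  - move=> x; rewrite /S mulrA bound// !normrM normrN !normr_sg.
    rewrite [`|pi / 2|]ger0_norm ?divr_ge0 ?pi_ge0//.
    by case: (X x != 0); case: (Y x != 0); rewrite ?mulr1 ?mul1r ?mulr0 ?mul0r// divr_ge0 ?pi_ge0.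
  - by move=> x /out/J0 h; rewrite /S h !mulr0.
have E1 : (\int[leb2]_x (X x / (X x ^+ 2 + Y x ^+ 2) * D1 x)%:E = \int[leb2]_x (A1 x)%:E)%E.
  rewrite -(@integral12_prod_meas1 _ _ _ _ _ mu mu _ iT1).
  rewrite -(@integral12_prod_meas1 _ _ _ _ _ mu mu _ iA1).
  apply: ae_ext_integral; exists [set c.1]; split => //; first exact: lebesgue_measure_set1.
  move=> x /=; apply: contra_notP => xc _.
  have dline (y : R) := (is_derive_partial2 _ _ _ _).2 (dD1 (x, y)).
  have parts := @integral_atan_by_parts _ (fun y => D1 (x, y)) (fun y => J (x, y)) (x - c.1) c.2 M0.
  transitivity (\int[mu]_y ((x - c.1) / ((x - c.1) ^+ 2 + (y - c.2) ^+ 2) *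
    D1 (x, y))%:E)%E; first by apply: eq_integral.
  transitivity (\int[mu]_y (- (atan ((y - c.2) / (x - c.1)) * J (x, y)))%:E)%E;
    last by apply: eq_integral.
  apply: (parts _ _ dline) => //.
  - by rewrite subr_eq0; apply/eqP.
  - exact: continuous_section2.
  - by move=> y My; apply/D10/out; right.
  - by move=> y My; apply/J0/out; right.
have E2 : (\int[leb2]_x (Y x / (Y x ^+ 2 + X x ^+ 2) * D2 x)%:E = \int[leb2]_x (A2 x)%:E)%E.
  rewrite -(@integral21_prod_meas1 _ _ _ _ _ mu mu _ iT2).
  rewrite -(@integral21_prod_meas1 _ _ _ _ _ mu mu _ iA2).
  apply: ae_ext_integral; exists [set c.2]; split => //; first exact: lebesgue_measure_set1.
  move=> y /=; apply: contra_notP => yc _.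
  have dline (x : R) := (is_derive_partial1 _ _ _ _).2 (dD2 (x, y)).
  have parts := @integral_atan_by_parts _ (fun x => D2 (x, y)) (fun x => J (x, y)) (y - c.2) c.1 M0.
  transitivity (\int[mu]_x ((y - c.2) / ((y - c.2) ^+ 2 + (x - c.1) ^+ 2) *
    D2 (x, y))%:E)%E; first by apply: eq_integral.
  transitivity (\int[mu]_x (- (atan ((x - c.1) / (y - c.2)) * J (x, y)))%:E)%E;
    last by apply: eq_integral.
  apply: (parts _ _ dline) => //.
  - by rewrite subr_eq0; apply/eqP.
  - exact: continuous_section1.
  - by move=> x Mx; apply/D20/out; left.
  - by move=> x Mx; apply/J0/out; left.
rewrite [LHS](integralD measurableT iT1 iT2) E1 E2 -(integralD measurableT iA1 iA2).
transitivity (\int[leb2]_x (S x)%:E)%E.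
  apply: ae_ext_integral.
  exists ([set c.1] `*` setT `|` setT `*` [set c.2]); split.
  - by apply: measurableU; apply: measurableX.
  - rewrite null_set_setU//; [by apply: measurableX..|exact: leb2_vertical|exact: leb2_horizontal].
  - move=> x /=; apply: contra_notP => /not_orP[xc1 xc2] _.
    have X0 : X x != 0 by rewrite subr_eq0; apply/eqP => h; apply: xc1; split.
    have Y0 : Y x != 0 by rewrite subr_eq0; apply/eqP => h; apply: xc2; split.
    have := atan_inv (mulf_neq0 X0 (invr_neq0 Y0)).
    rewrite invf_div sgrM sgrV => h.
    rewrite /A1 /A2 /S -EFinD -opprD -mulrDl addrC h; congr EFin; ring.
rewrite -(@integral12_prod_meas1 _ _ _ _ _ mu mu _ iS).
transitivity (\int[mu]_x (Num.sg (x - c.1) * (pi * D1 (x, c.2)))%:E)%E.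
  apply: eq_integral => x _.
  pose k : R := - (pi / 2) * Num.sg (x - c.1).
  rewrite [LHS](@integral_line_sg_derivative _ (fun y => k * D1 (x, y))
    (fun y => k * J (x, y)) M0)//.
  - by congr EFin; rewrite /k; field.
  - by apply: le_lt_trans cM; rewrite lerDr.
  - move=> y; apply: (is_deriveZ k); exact/is_derive_partial2.
  - by move=> y; apply: cvgM; [exact: cvg_cst|exact: continuous_section2].
  - by move=> y My; rewrite D10 ?mulr0//; apply: out; right.
  - by move=> y My; rewrite J0 ?mulr0//; apply: out; right.
rewrite [LHS](@integral_line_sg_derivative _ (fun x => pi * phi (x, c.2))
  (fun x => pi * D1 (x, c.2)) M0)//.
- by congr EFin; rewrite -surjective_pairing; ring.
- by apply: le_lt_trans cM; rewrite lerDl.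
- move=> x; apply: (is_deriveZ pi); exact/is_derive_partial1.
- move=> x; apply: cvgM; first exact: cvg_cst.
  by apply: (@continuous_section1 _ D1); exact: Ck_continuous cD1.
- by move=> x Mx; rewrite phi0 ?mulr0//; apply: out; left.
- by move=> x Mx; rewrite D10 ?mulr0//; apply: out; left.
Qed.

End point_source.

(** * Barycentric coordinates and null lines *)

Section triangles.
Context {R : realType}.
Implicit Types (P : 'I_3 -> R * R) (x y : R * R) (i j : 'I_3).

Let v0 : 'I_3 := ord0.
Let v1 : 'I_3 := lift ord0 ord0.
Let v2 : 'I_3 := lift ord0 (lift ord0 ord0).

Let vertexP i : [\/ i = v0, i = v1 | i = v2].
Proof.
case: i => [[|[|[|//]]] ?]; [constructor 1|constructor 2|constructor 3];
  exact: val_inj.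
Qed.

Let sum3 (V : zmodType) (F : 'I_3 -> V) : \sum_i F i = F v0 + (F v1 + F v2).
Proof. by rewrite !big_ord_recl big_ord0 addr0. Qed.

Definition succ3 i : 'I_3 := if i == v0 then v1 else if i == v1 then v2 else v0.

Let succ0 : succ3 v0 = v1. Proof. by []. Qed.
Let succ1 : succ3 v1 = v2. Proof. by []. Qed.
Let succ2 : succ3 v2 = v0. Proof. by []. Qed.

(** Twice the signed area of the triangle with vertices [x], [y], [z]. *)
Definition area2 x y (z : R * R) : R :=
  (y.1 - x.1) * (z.2 - x.2) - (y.2 - x.2) * (z.1 - x.1).

Definition triangle_area2 P : R := area2 (P v0) (P v1) (P v2).

Definition bary_a P i : R :=
  ((P (succ3 i)).2 - (P (succ3 (succ3 i))).2) / triangle_area2 P.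
Definition bary_b P i : R :=
  ((P (succ3 (succ3 i))).1 - (P (succ3 i)).1) / triangle_area2 P.
Definition bary_c P i : R :=
  ((P (succ3 i)).1 * (P (succ3 (succ3 i))).2
    - (P (succ3 i)).2 * (P (succ3 (succ3 i))).1) / triangle_area2 P.

(** Barycentric coordinates, written as affine functions so that smooth functions can
    be composed with them through Ck_comp_affine. *)
Definition bary P i x : R := bary_a P i * x.1 + bary_b P i * x.2 + bary_c P i.

Variable P : 'I_3 -> R * R.
Hypothesis P_nd : nondegenerate_triangle P.

Let area0 : triangle_area2 P != 0.
Proof. exact: (P_nd (a := v0) (b := v1) (c := v2)). Qed.

Lemma bary_sum x : \sum_i bary P i x = 1.
Proof.
rewrite sum3 /bary /bary_a /bary_b /bary_c succ0 succ1 succ2 ?succ0.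
move: area0; rewrite /triangle_area2 /area2.
by case: (P v0) (P v1) (P v2) x => a1 a2 [b1 b2] [c1 c2] [x1 x2] /= h; field.
Qed.

Lemma bary_combination x : x = \sum_i bary P i x *: P i.
Proof.
rewrite sum3 /bary /bary_a /bary_b /bary_c succ0 succ1 succ2 ?succ0.
move: area0; rewrite /triangle_area2 /area2.
case: (P v0) (P v1) (P v2) x => a1 a2 [b1 b2] [c1 c2] [x1 x2] /= h.
by rewrite [RHS]surjective_pairing /= /GRing.scale/=; congr (_, _); field.
Qed.

Lemma baryE (l : 'I_3 -> R) i : \sum_i l i = 1 ->
  bary P i (\sum_i l i *: P i) = l i.
Proof.
rewrite !sum3 => l1; have l0 : l v0 = 1 - (l v1 + l v2) by rewrite -l1 addrK.
move: area0; rewrite /bary /bary_a /bary_b /bary_c /triangle_area2 /area2.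
case: (vertexP i) => ->; rewrite ?succ0 ?succ1 ?succ2 ?succ0 ?l0;
  case: (P v0) (P v1) (P v2) (l v1) (l v2) => a1 a2 [b1 b2] [c1 c2] m1 m2 /=;
  rewrite /GRing.scale/= => h; by field.
Qed.

Lemma bary_nonconstant i : bary_a P i != 0 \/ bary_b P i != 0.
Proof.
apply/orP; rewrite -negb_and; apply/negP => /andP[/eqP a0 /eqP b0].
(* A constant coordinate would take the same value at all three vertices. *)
have value j : bary P i (P j) = (i == j)%:R.
  have := @baryE (fun k => (k == j)%:R) i.
  rewrite (bigD1 j)//= eqxx big1 ?addr0; last by move=> k /negbTE ->.
  rewrite (bigD1 j)//= eqxx scale1r big1 ?addr0 => [->//|k /negbTE ->].
  by rewrite scale0r.
have : bary P i (P i) = bary P i (P (succ3 i)).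
  by rewrite /bary a0 b0 !mul0r.
rewrite !value eqxx; case: (vertexP i) => ->; rewrite ?succ0 ?succ1 ?succ2 /=;
  by move/eqP; rewrite oner_eq0.
Qed.

Lemma faceE (J : pred 'I_3) : face P J =
  [set x | (forall i, 0 <= bary P i x) /\ (forall i, ~~ J i -> bary P i x = 0)].
Proof.
apply/seteqP; split=> x [].
  by move=> l [l0 lJ l1 ->]; split=> i; rewrite baryE//; exact: lJ.
move=> b0 bJ; exists (fun i => bary P i x); split => //.
- exact: bary_sum.
- exact: bary_combination.
Qed.

Lemma continuous_bary i : continuous (bary P i).
Proof. exact: continuous_affine. Qed.

Lemma open_bary_gt0 : open [set x | forall i, 0 < bary P i x].
Proof.
rewrite openE => x h.
suff : \forall y \near x, forall i, 0 < bary P i y by [].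
apply: (filter_forall (nbhs_filter x)) => i.
exact: (@continuous_bary i x _ (lt_nbhsr (h i))).
Qed.

Lemma closed_bary_ge (e : R) : closed [set x | forall i, e <= bary P i x].
Proof.
rewrite (_ : [set x | _] = \bigcap_(i in [set: 'I_3]) (bary P i @^-1` [set t | e <= t])).
  apply: closed_bigI => i _; apply: closed_comp => [x _|]; last exact: closed_ge.
  exact: continuous_bary.
by apply/seteqP; split=> x h i; [move=> _; exact: h|exact: h].
Qed.

Lemma bary_ge0_bounded x : (forall i, 0 <= bary P i x) ->
  `|x| <= \sum_i `|P i|.
Proof.
move=> b0; rewrite {1}(bary_combination x) (le_trans (ler_norm_sum _ _ _))//.
apply: ler_sum => i _; rewrite normrZ ger0_norm// ler_piMl//.
rewrite -(bary_sum x) (bigD1 i)//= lerDl; exact: sumr_ge0.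
Qed.

Lemma compact_bary_ge (e : R) : 0 <= e -> compact [set x | forall i, e <= bary P i x].
Proof.
move=> e0; pose M := \sum_i `|P i|.
apply: (@subclosed_compact _ _ (`[- M, M] `*` `[- M, M])).
- exact: closed_bary_ge.
- by apply: compact_setX; exact: segment_compact.
move=> x be; have := bary_ge0_bounded (fun i => le_trans e0 (be i)).
by rewrite prod_normE ge_max !ler_norml => /andP[h1 h2]; split; rewrite /= in_itv.
Qed.

Lemma bary_gt0_interior : [set x | forall i, 0 < bary P i x] `<=` (face P predT)°.
Proof.
rewrite faceE => x h.
have : nbhs x [set x | forall i, 0 < bary P i x].
  by apply: open_nbhs_nbhs; split => //; exact: open_bary_gt0.
by apply: filterS => y hy; split => // i; exact/ltW/hy.
Qed.

End triangles.

Section null_lines.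
Context {R : realType}.

(** Every slice of the line parallel to a suitable axis is a point. *)
Lemma leb2_line (a b c : R) : a != 0 \/ b != 0 ->
  leb2.-negligible ([set x | a * x.1 + b * x.2 + c = 0] : set (mplane R)).
Proof.
set L : set (mplane R) := [set x | _].
have mL : measurable L.
  apply: closed_measurable_plane.
  rewrite (_ : L = (fun x : R * R => a * x.1 + b * x.2 + c) @^-1` [set 0])//.
  apply: closed_comp => [x _|]; [exact: continuous_affine|exact: closed_eq].
have [b0|b0] := eqVneq b 0.
  rewrite ?eqxx => -[a0|//].
  exists ([set - c / a] `*` setT); split; first exact: measurableX.
    exact: leb2_vertical.
  move=> x; rewrite /L /= b0 mul0r addr0 => h; split => //=.
  by apply: (mulfI a0); rewrite mulrCA mulfV// mulr1; apply/eqP; rewrite -addr_eq0 h.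
move=> _; exists L; split => //.
transitivity (\int[lebesgue_measure]_x (lebesgue_measure (xsection L x)))%E => //.
apply: integral0_eq => x _.
apply/eqP; rewrite -measure_le0 -(lebesgue_measure_set1 (- (a * x + c) / b)).
apply: le_measure; rewrite ?inE//; first exact: measurable_xsection.
move=> y /xsectionP /= h; apply: (mulfI b0).
by rewrite mulrCA mulfV// mulr1; apply/eqP; rewrite -addr_eq0 addrCA addrA h.
Qed.

End null_lines.

(** * Lipschitz domains *)

Section lipschitz_domains.
Context {R : realType}.
Implicit Types (D : set (R * R)).

Lemma ler_norm_enorm (v : R * R) : `|v| <= enorm v.
Proof. by rewrite prod_normE ge_max ler_fst_enorm ler_snd_enorm. Qed.

Lemma ler_enorm_norm (v : R * R) : enorm v <= `|v| * 2.
Proof.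
rewrite mulr_natr mulr2n (le_trans (enorm_ler_sum v))// lerD//.
  by rewrite prod_normE le_max lexx.
by rewrite prod_normE le_max lexx orbT.
Qed.

Lemma bounded_leb2_fin D : measurable (D : set (mplane R)) -> bounded_set D ->
  (leb2 D < +oo)%E.
Proof.
move=> mD [M [_ DM]]; pose N := `|M| + 1.
have mB : measurable (`[- N, N] `*` `[- N, N] : set (mplane R)).
  by apply: measurableX; exact: measurable_itv.
apply: le_lt_trans (leb2_box_fin N); apply: le_measure; rewrite ?inE//.
move=> x Dx; have : `|x| <= N by apply: DM => //; rewrite ltr_pwDr// ler_norm.
by rewrite prod_normE ge_max !ler_norml => /andP[h1 h2]; split; rewrite /= in_itv.
Qed.

Let lt_min_third (t r : R) : 0 < t -> t * 3 <= r -> t < r.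
Proof. by move=> *; lra. Qed.

Let below_graph (a b g1 g2 L t n : R) : a <= g1 -> `|g1 - g2| <= L * n ->
  `|a - t - b| <= n -> L * n + n < t -> ~ (g2 < b).
Proof. by rewrite !ler_norml => *; lra. Qed.

(** A Lipschitz domain does not lie on both sides of its boundary: a small step
    from a boundary point against the direction of the graph leaves the closure.
    Hence the interior of a triangle, which only lies in the closure of the domain
    by assumption, lies in the domain. *)
Lemma interior_closure_lipschitz D : open D -> lipschitz_boundary D ->
  (closure D)° `<=` D.
Proof.
move=> oD lD x clDx; apply: contrapT => nDx.
have bx : boundary D x.
  by split; [exact: interior_subset|rewrite (interior_id _).1].
have [e [gamma [L [delta [e1 d0 gL Dgraph]]]]] := lD x bx.
have /nbhs_ballP[r /= r0 rD] : nbhs x (closure D) by [].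
have ee : dot e e = 1 by rewrite -sqr_enorm e1 expr1n.
pose t := Num.min r delta / 3.
have m0 : 0 < Num.min r delta by rewrite lt_min r0.
have t0 : 0 < t by rewrite divr_gt0.
pose n := t / (`|L| + 2).
have L2 : 0 < `|L| + 2 by rewrite ltr_wpDl.
have n0 : 0 < n by rewrite divr_gt0.
(* A ball of radius n around the point at depth t stays below the graph. *)
have nt : `|L| * n + n < t.
  rewrite -[X in _ + X]mul1r -mulrDl /n mulrCA -[X in _ < X]mulr1 ltr_pM2l//.
  by rewrite ltr_pdivrMr// mul1r ltrD2l ltr1n.
pose y := x - t *: e.
have etx : enorm (y - x) = t.
  by rewrite /y addrAC subrr add0r enormN enormZ e1 mulr1 (gtr0_norm t0).
have trd : t * 3 = Num.min r delta by rewrite /t divfK.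
have tr : t < r by apply: lt_min_third => //; rewrite trd ge_min lexx.
have td : n + t < delta.
  have : Num.min r delta <= delta by rewrite ge_min lexx orbT.
  have : n <= t.
    by rewrite /n ler_pdivrMr// (ler_peMr (ltW t0))// ler_wpDl ?ler1n.
  by rewrite -trd; move: t0; clear; lra.
have /rD : ball x r y.
  rewrite -ball_normE /ball_/= distrC; apply: le_lt_trans (ler_norm_enorm _) _.
  by rewrite etx.
have Uy : nbhs y (ball y (n / 2)) by apply: nbhsx_ballx; exact: divr_gt0.
move=> /(_ _ Uy)[z [Dz]]; rewrite -ball_normE /ball_/= => zy.
have ezy : enorm (y - z) < n.
  by apply: le_lt_trans (ler_enorm_norm _) _; rewrite -ltr_pdivlMr.
have ezx : enorm (z - x) < delta.
  rewrite (_ : z - x = - (y - z) + (y - x)); last by rewrite opprB addrA subrK.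
  apply: le_lt_trans (ler_enormD _ _) _; rewrite enormN etx.
  by apply: lt_trans td; rewrite ltrD2r.
move/(Dgraph z ezx): Dz; set o := (e.2, - e.1).
have eo : enorm o = 1 by rewrite -e1 /enorm /dot/= mulrNN addrC.
have dyo : dot y o = dot x o by rewrite /y /o /dot/= /GRing.scale/=; ring.
have dye : dot y e = dot x e - t.
  by rewrite -[X in _ - X]mulr1 -ee /y /dot/= /GRing.scale/=; ring.
have dB (v : R * R) : enorm v = 1 -> `|dot y v - dot z v| <= n.
  move=> v1; rewrite (_ : _ - _ = dot (y - z) v); last by rewrite /dot/=; ring.
  by apply: le_trans (cauchy_schwarz _ _) _; rewrite v1 mulr1 ltW.
apply: (below_graph (a := dot x e) (g1 := gamma (dot x o)) (L := `|L|) _ _ _ nt).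
- rewrite leNgt; apply/negP => h; apply: nDx; apply/Dgraph => //.
  by rewrite subrr /enorm /dot/= !mul0r addr0 sqrtr0.
- apply: le_trans (gL _ _) _; apply: le_trans (ler_wpM2r (normr_ge0 _) (ler_norm L)) _.
  by rewrite ler_wpM2l// -dyo; exact: dB.
- by rewrite -dye; exact: dB.
Qed.

End lipschitz_domains.

(** * Geometry of a triangulation *)

Section mesh_geometry.
Context {R : realType} (D : set (R * R)) (T : mesh R).
Hypotheses (oD : open D) (lD : lipschitz_boundary D) (triT : triangulation D T).
Implicit Types (k : 'I_(ncells T)).

Let nd k : nondegenerate_triangle (vertex k).
Proof. by case: triT. Qed.

Lemma measurable_cell k : measurable (cell k : set (mplane R)).
Proof.
apply: closed_measurable_plane; rewrite /cell faceE//.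
rewrite (_ : [set x | _] = [set x | forall i, 0 <= bary (vertex k) i x]).
  exact: closed_bary_ge.
by apply/seteqP; split=> x; [case|move=> h; split].
Qed.

Lemma measurable_interior_cell k : measurable ((cell k)° : set (mplane R)).
Proof. by apply: open_measurable_plane; exact: open_interior. Qed.

Lemma cell_bary_ge0 k x i : cell k x -> 0 <= bary (vertex k) i x.
Proof. by rewrite /cell faceE// => -[]. Qed.

Lemma interior_cell_subset k : (cell k)° `<=` D.
Proof.
apply: subset_trans (interior_closure_lipschitz oD lD).
apply: interiorS => x kx; case: triT => -> _ _; by exists k.
Qed.

Lemma cell_bounded k x : cell k x -> `|x| <= \sum_i `|vertex k i|.
Proof.
by move=> kx; apply: bary_ge0_bounded => // i; exact: cell_bary_ge0.
Qed.

Lemma leb2_cell_fin k : (leb2 (cell k) < +oo)%E.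
Proof.
apply: bounded_leb2_fin; first exact: measurable_cell.
exists (\sum_i `|vertex k i|); split; first exact: num_real.
by move=> M /ltW PM x kx; apply: le_trans PM; exact: cell_bounded.
Qed.

Let edge_null k i : {ae leb2, forall x : mplane R, bary (vertex k) i x <> 0}.
Proof.
have [N [mN N0 sN]] := leb2_line (bary_c (vertex k) i) (bary_nonconstant (nd k) i).
by exists N; split => // x /contrapT h; exact: sN.
Qed.

(** The edges are null sets, and two different triangles only share points of their
    edges; off this null set the domain is a disjoint union of open triangles. *)
Lemma ae_cell : {ae leb2, forall x : mplane R,
  (D x -> exists k, cell k x) /\ forall k, cell k x ->
    [/\ forall i, 0 < bary (vertex k) i x, (cell k)° x, D x &
        forall k', cell k' x -> k' = k]}.
Proof.
have : {ae leb2, forall x : mplane R, forall k i, bary (vertex k) i x <> 0}.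
  apply: (filter_forall (leb2_ae_filter R)) => k.
  by apply: (filter_forall (leb2_ae_filter R)) => i; exact: edge_null.
apply: filterS => x nz; split=> [Dx|k kx].
  have : closure D x by exact: subset_closure.
  by case: triT => -> _ _ [k _ kx]; exists k.
have b0 k1 i : cell k1 x -> 0 < bary (vertex k1) i x.
  by move=> h; rewrite lt_neqAle cell_bary_ge0// andbT eq_sym; exact/eqP/nz.
have ik : (cell k)° x.
  by apply: bary_gt0_interior => // i; exact: b0.
split=> // [i||k' k'x]; [exact: b0|exact: interior_cell_subset ik|].
apply/eqP; apply: contrapT => /negP k'k.
case: triT => _ _ /(_ _ _ k'k)[J [J' [[i Ji] _ E _]]].
have : face (vertex k') J x by rewrite -E.
by rewrite faceE// => -[_ /(_ i Ji)]; exact: nz.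
Qed.

Lemma ae_interior_cell k : {ae leb2, forall x : mplane R, cell k x <-> (cell k)° x}.
Proof.
apply: filterS ae_cell => x [_ h]; split; last exact: interior_subset.
by move=> /h[].
Qed.

Lemma diam_mesh_size k : diam (cell k) <= mesh_size T.
Proof. by rewrite /mesh_size; exact: le_bigmax. Qed.

Lemma mesh_size_ge0 : 0 <= mesh_size T.
Proof. exact: bigmax_ge_id. Qed.

End mesh_geometry.

(** * Integrals over a triangulation *)

Section cellwise_integrals.
Context {R : realType} (D : set (R * R)) (T : mesh R).
Hypotheses (oD : open D) (lD : lipschitz_boundary D) (triT : triangulation D T).
Implicit Types (k : 'I_(ncells T)) (f : R * R -> R).

Let mD : measurable (D : set (mplane R)).
Proof. exact: open_measurable_plane. Qed.

Let mI k : measurable ((cell k)° : set (mplane R)).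
Proof. exact: measurable_interior_cell. Qed.

Let ae_patch f : {ae leb2, forall x : mplane R,
  (f \_ D) x = \sum_(k < ncells T) (f \_ (cell k)°) x}.
Proof.
apply: filterS (ae_cell oD lD triT) => x [Dcell cellx]; rewrite patchE.
case: ifPn => [/set_mem /Dcell[k kx]|/negP nDx].
  have [_ ikx _ uk] := cellx k kx.
  rewrite (bigD1 k)//= patchE mem_set// big1 ?addr0// => j jk.
  rewrite patchE; case: ifPn => // /set_mem /interior_subset /uk /eqP.
  by rewrite (negbTE jk).
rewrite big1// => k _; rewrite patchE; case: ifPn => // /set_mem kx.
by case: nDx; rewrite inE; exact: (interior_cell_subset oD lD triT) kx.
Qed.

Lemma Rintegral_bigsum (I : Type) (r : seq I) (F : I -> mplane R -> R) :
  (forall i, leb2.-integrable setT (EFin \o F i)) ->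
  \int[leb2]_x (\sum_(i <- r) F i x) = \sum_(i <- r) \int[leb2]_x F i x /\
  leb2.-integrable setT (EFin \o (fun x => \sum_(i <- r) F i x)).
Proof.
move=> iF; elim: r => [|i r [ih1 ih2]].
  rewrite big_nil; split.
    by under eq_Rintegral do rewrite big_nil; rewrite Rintegral_cst// mul0r.
  apply: (eq_integrable measurableT (cst 0%E)); last exact: integrable0.
  by move=> x _; rewrite /= big_nil.
rewrite big_cons; split.
  by under eq_Rintegral do rewrite big_cons; rewrite RintegralD// ih1.
apply: (eq_integrable measurableT ((EFin \o F i) \+ (EFin \o
  (fun x => (\sum_(i <- r) F i x)%R)))%E); last exact: integrableD.
by move=> x _; rewrite /= big_cons.
Qed.

Lemma Rintegral_cells f : leb2.-integrable D (EFin \o f) ->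
  \int[leb2]_(x in D) f x = \sum_(k < ncells T) \int[leb2]_(x in (cell k)°) f x.
Proof.
move=> iF; rewrite Rintegral_mkcond.
under eq_bigr do rewrite Rintegral_mkcond.
have iFk k : leb2.-integrable setT (EFin \o (f \_ (cell k)°)).
  rewrite -restrict_EFin -integrable_mkcond//.
  by apply: integrableS iF => //; exact: interior_cell_subset.
rewrite -(Rintegral_bigsum _ iFk).1.
by apply: ae_ext_Rintegral; apply: filterS (ae_patch f) => x h _.
Qed.

Lemma ge0_integral_cells f : measurable_fun D (f : mplane R -> R) ->
  (forall x, 0 <= f x) ->
  (\int[leb2]_(x in D) (f x)%:E = \sum_(k < ncells T) \int[leb2]_(x in (cell k)°) (f x)%:E)%E.
Proof.
move=> mf f0; rewrite integral_mkcond.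
under eq_bigr do rewrite integral_mkcond.
rewrite -ge0_integral_sum//.
- apply: ae_ext_integral; apply: filterS (ae_patch f) => x h _.
  have E (B : set (R * R)) : ((fun x => (f x)%:E) \_ B) x = ((f \_ B) x)%:E.
    by rewrite !patchE; case: ifP.
  by rewrite E h -sumEFin; apply: eq_bigr => k _; rewrite E.
- move=> k; rewrite restrict_EFin; apply/measurable_EFinP.
  apply/(measurable_restrictT _ (mI k)).
  apply: (@measurable_funS _ _ _ _ D) => //.
  exact: (interior_cell_subset oD lD triT).
- by move=> k x _; rewrite patchE; case: ifP => // _; rewrite lee_fin.
Qed.

Lemma Rintegral_interior_cell k f :
  \int[leb2]_(x in (cell k)°) f x = \int[leb2]_(x in cell k) f x.
Proof.
rewrite Rintegral_mkcond [RHS]Rintegral_mkcond; apply: ae_ext_Rintegral.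
apply: filterS (ae_interior_cell oD lD triT k) => x h _; rewrite !patchE.
by congr (if _ then _ else _); apply/idP/idP; rewrite !inE => /h.
Qed.

Lemma leb2_interior_cell k : leb2 ((cell k)°) = leb2 (cell k).
Proof.
rewrite -[LHS]mul1e -[RHS]mul1e -!integral_cst//; last exact: (measurable_cell triT).
rewrite integral_mkcond [RHS]integral_mkcond; apply: ae_ext_integral.
apply: filterS (ae_interior_cell oD lD triT k) => x h _; rewrite !patchE.
by congr (if _ then _ else _); apply/idP/idP; rewrite !inE => /h.
Qed.

End cellwise_integrals.

(** * Cutoff functions of a triangle *)

Lemma eq_cvg_seq (T : topologicalType) (u v : nat -> T) (l : T) :
  u =1 v -> u @ \oo --> l -> v @ \oo --> l.
Proof. by move=> /funext ->. Qed.

Section cutoff.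
Context {R : realType}.
Implicit Types (P : 'I_3 -> R * R).

(** Smooth functions that vanish near the boundary of the triangle and tend to 1
    inside it. *)
Definition cutoff P (n : nat) (x : R * R) : R :=
  \prod_(i < 3) smooth_step (n%:R * bary P i x - 1).

Lemma cutoff_bounds P n x : 0 <= cutoff P n x <= 1.
Proof.
rewrite /cutoff; elim/big_ind : _ => [|s t /andP[s0 s1] /andP[t0 t1]|i _].
- by rewrite ler01 lexx.
- by rewrite mulr_ge0// mulr_ile1.
- exact: smooth_step_bounds.
Qed.

Lemma Ck_prod n (I : Type) (r : seq I) (F : I -> R * R -> R) :
  (forall i, Ck n (F i)) -> Ck n (fun x => \prod_(i <- r) F i x).
Proof.
move=> cF; elim: r => [|i r ih].
  rewrite (_ : (fun x => _) = cst 1); first exact: Ck_cst.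
  by apply/funext => x; rewrite big_nil.
rewrite (_ : (fun x => _) = (fun x => F i x * \prod_(j <- r) F j x)).
  exact: CkM.
by apply/funext => x; rewrite big_cons.
Qed.

Lemma smooth_cutoff P n : smooth (cutoff P n).
Proof.
move=> m; apply: Ck_prod => i.
rewrite (_ : (fun x => _) = (fun x => flat_exp (flat_poly 0)
  (n%:R * bary_a P i * x.1 + n%:R * bary_b P i * x.2 + (n%:R * bary_c P i - 1)))).
  exact: (Ck_comp_affine _ _ _ _ _ is_derive_flat_poly).
apply/funext => x; rewrite /smooth_step /bary; congr flat_exp; ring.
Qed.

Lemma smoothM (u w : R * R -> R) : smooth u -> smooth w -> smooth (fun x => u x * w x).
Proof. by move=> su sw n; exact: CkM. Qed.

Lemma cutoff_neq0 P n x i : cutoff P n x != 0 -> n%:R^-1 <= bary P i x /\ (0 < n)%N.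
Proof.
move=> /prodf_neq0 /(_ i isT) s0.
have : 0 < n%:R * bary P i x - 1.
  by rewrite ltNge; apply: contra s0 => /smooth_step_le0 ->.
rewrite subr_gt0; case: n {s0} => [|n]; first by rewrite mul0r ltr10.
by move=> /ltW h; split => //; rewrite -[X in X <= _]mulr1 ler_pdivrMl.
Qed.

Lemma cutoff_cvg P x : (forall i, 0 < bary P i x) ->
  cutoff P n x @[n --> \oo] --> (1 : R).
Proof.
move=> b0; pose s i n : R := smooth_step (n%:R * bary P i x - 1).
have c i : s i n @[n --> \oo] --> (1 : R) by exact: smooth_step_cvg.
have E : cutoff P ^~ x =
    (fun n => s ord0 n * (s (lift ord0 ord0) n * s (lift ord0 (lift ord0 ord0)) n)).
  by apply/funext => n; rewrite /cutoff !big_ord_recl big_ord0 mulr1.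
apply: (eq_ind_r (fun g : nat -> R => g @ \oo --> (1 : R)) _ E).
have := cvgM (c ord0) (cvgM (c (lift ord0 ord0)) (c (lift ord0 (lift ord0 ord0)))).
by rewrite !mulr1 => cc; exact: cc.
Qed.

End cutoff.

Section cell_divergence.
Context {R : realType} (D : set (R * R)) (T : mesh R).
Hypotheses (oD : open D) (lD : lipschitz_boundary D) (triT : triangulation D T).
Variable k : 'I_(ncells T).
Let V := vertex k.
Let nd : nondegenerate_triangle V.
Proof. by case: triT => _ + _; exact. Qed.
Let mD : measurable (D : set (mplane R)).
Proof. exact: open_measurable_plane. Qed.
Let mI : measurable ((cell k)° : set (mplane R)).
Proof. exact: measurable_interior_cell. Qed.

Let cutoff_out n x : ~ (cell k)° x -> cutoff V n x = 0.
Proof.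
move=> nx; apply/eqP; apply: contrapT => /negP c0; apply: nx.
apply: bary_gt0_interior => // i; have [h n0] := cutoff_neq0 i c0.
by apply: lt_le_trans h; rewrite invr_gt0 ltr0n.
Qed.

Lemma test_fun_cutoff n (w : R * R -> R) : smooth w ->
  test_fun (cell k)° (fun x => w x * cutoff V n x).
Proof.
move=> sw; split; first by apply: smoothM => //; exact: smooth_cutoff.
have [n0|n0] := posnP n.
  exists set0; split=> // [|x _]; first exact: compact0.
  have [->|/(cutoff_neq0 ord0)[_]] := eqVneq (cutoff V n x) 0; first by rewrite mulr0.
  by rewrite n0.
exists [set x | forall i, n%:R^-1 <= bary V i x]; split.
- by apply: compact_bary_ge => //; rewrite invr_ge0.
- move=> x h; apply: bary_gt0_interior => // i.
  by apply: lt_le_trans (h i); rewrite invr_gt0 ltr0n.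
move=> x nx; have [->|c0] := eqVneq (cutoff V n x) 0; first by rewrite mulr0.
by case: nx => i; have [] := cutoff_neq0 i c0.
Qed.

Lemma test_fun_subset (phi : R * R -> R) :
  test_fun (cell k)° phi -> test_fun D phi.
Proof.
case=> s [K [cK KI phi0]]; split=> //; exists K; split => //.
exact: (subset_trans KI (interior_cell_subset oD lD triT (k := k))).
Qed.

(** The cutoffs tend to the indicator of the triangle almost everywhere and are
    bounded by 1, so that dominated convergence applies. *)
Lemma cutoff_integral_eq0 (h : R * R -> R) : leb2.-integrable D (EFin \o h) ->
  (forall n, \int[leb2]_(x in D) (h x * cutoff V n x) = 0) ->
  \int[leb2]_(x in (cell k)°) h x = 0.
Proof.
move=> ih h0.
have mh := (measurable_EFinP _ _).1 (measurable_int _ ih).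
have mcut n : measurable_fun D (cutoff V n : mplane R -> R).
  apply: measurable_funTS; apply: continuous_measurable_plane.
  exact: Ck_continuous (smooth_cutoff V n 0).
have bcut n x : `|cutoff V n x| <= 1.
  by have /andP[c0 c1] := cutoff_bounds V n x; rewrite ger0_norm.
have [] := @dominated_convergence _ (mplane R) R leb2 D mD
  (fun n x => (h x * cutoff V n x)%:E) (fun x => (EFin \o (h \_ (cell k)°)) x)
  (fun x => `|(EFin \o h) x|)%E.
- by move=> n; apply/measurable_EFinP; exact: (measurable_funM mh (mcut n)).
- apply/measurable_EFinP; apply/(measurable_restrict _ mI mD).
  by apply: (@measurable_funS _ _ _ _ D) => //; exact: subIsetl.
- apply: filterS (ae_cell oD lD triT) => x [_ kx] Dx; apply: cvg_EFin; first exact: nearW.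
  rewrite /= patchE; case: ifPn => [/set_mem xk|].
    have bx : forall i, 0 < bary V i x by have [] := kx k (interior_subset xk).
    by have := cvgM (cvg_cst (h x)) (cutoff_cvg bx); rewrite mulr1 => cc; exact: cc.
  rewrite notin_setE => nx; apply: (eq_cvg_seq (u := cst 0)); last exact: cvg_cst.
  by move=> n /=; rewrite cutoff_out ?mulr0.
- exact: integrable_abse.
- apply: aeW => x n Dx; rewrite lee_fin normrM -[leRHS]mulr1.
  by rewrite ler_wpM2l.
move=> _ _ lim; rewrite Rintegral_mkcond.
have zero n : (\int[leb2]_(x in D) (h x * cutoff V n x)%:E = 0)%E.
  have fin : (\int[leb2]_(x in D) (h x * cutoff V n x)%:E)%E \is a fin_num.
    apply: integrable_fin_num => //.
    apply: (@bounded_mul_integrable _ _ mD h (cutoff V n) 1) => //; first exact: mcut.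
    by apply: aeW => x _; exact: bcut.
  by rewrite -(fineK fin); congr EFin; exact: h0.
have lim0 : (cst 0%E : nat -> \bar R) @ \oo -->
    (\int[leb2]_(x in D) (EFin \o (h \_ (cell k)°)) x)%E.
  by apply: eq_cvg_seq lim => n /=; rewrite zero.
have E := cvg_unique (@ereal_hausdorff R) lim0 (cvg_cst 0%E).
have ID := interior_cell_subset oD lD triT (k := k).
suff : \int[leb2]_(x in D) (h \_ (cell k)°) x = 0.
  by rewrite Rintegral_mkcond -patch_setI (setIidr ID).
by rewrite /Rintegral E.
Qed.

End cell_divergence.

(** * Test functions *)

Section test_functions.
Context {R : realType}.
Implicit Types (phi w : R * R -> R) (U : set (R * R)).

Let add_parts (s t u v b p : R) : s * u + t * v =
  (s * u + p * b) + (t * v + p * b) - 2 * b * p.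
Proof. ring. Qed.

Lemma test_fun_continuous U phi : test_fun U phi ->
  [/\ continuous phi, continuous (fun x => 'D_(1, 0) phi x) &
      continuous (fun x => 'D_(0, 1) phi x)].
Proof.
case=> s _; have [_ _ c1 c2] := Ck_S (s 1%N).
by split; apply: Ck_continuous; [exact: s 0%N| exact: c1|exact: c2].
Qed.

Lemma test_fun_closed_support U phi : test_fun U phi -> exists K,
  [/\ compact K, closed K, K `<=` U & forall x, ~ K x -> phi x = 0].
Proof.
case=> _ [K [cK KU phi0]]; exists K; split => //.
by apply: compact_closed => //; exact: norm_hausdorff.
Qed.

Lemma test_fun_bounded U phi : test_fun U phi ->
  exists2 C, 0 <= C & forall x, `|phi x| <= C /\ enorm (grad phi x) <= C.
Proof.
move=> tphi; have [c0 c1 c2] := test_fun_continuous tphi.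
have [K [cK clK KU phi0]] := test_fun_closed_support tphi.
have [A A0 hA] := compact_support_bounded cK c0 phi0.
have [B B0 hB] := compact_support_bounded cK c1 (fun x => derive_outside_support (1, 0) clK phi0).
have [C C0 hC] := compact_support_bounded cK c2 (fun x => derive_outside_support (0, 1) clK phi0).
exists (A + (B + C)) => [|x]; first by rewrite !addr_ge0.
split; first by rewrite (le_trans (hA x))// lerDl addr_ge0.
apply: le_trans (enorm_ler_sum _) _; apply: le_trans (lerD (hB x) (hC x)) _.
by rewrite lerDr.
Qed.

Lemma test_fun_outside U phi x : test_fun U phi -> ~ U x ->
  phi x = 0 /\ grad phi x = (0, 0).
Proof.
move=> tphi nUx; have [K [_ clK KU phi0]] := test_fun_closed_support tphi.
have nKx : ~ K x by move=> /KU.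
by rewrite phi0// /grad !(derive_outside_support _ clK phi0).
Qed.

Lemma measurable_test_fun U phi : test_fun U phi ->
  [/\ measurable_fun setT (phi : mplane R -> R),
      measurable_fun setT (fst \o grad phi : mplane R -> R) &
      measurable_fun setT (snd \o grad phi : mplane R -> R)].
Proof.
by move=> /test_fun_continuous[c0 c1 c2]; split; exact: continuous_measurable_plane.
Qed.

Lemma test_fun_inL U D p phi : measurable (D : set (mplane R)) -> (leb2 D < +oo)%E ->
  1 <= p -> test_fun U phi -> inL D p%:E phi /\ inLv D p%:E (grad phi).
Proof.
move=> mD Dfin p1 tphi; have p0 : 0 < p by exact: lt_le_trans p1.
have [C C0 hC] := test_fun_bounded tphi.
have [m0 m1 m2] := measurable_test_fun tphi.
split; [|split]; apply: (@bounded_inL _ _ mD Dfin _ _ C) => //;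
  try exact: measurable_funTS; apply: aeW => x _; have [h1 h2] := hC x => //.
  by apply: le_trans h2; exact: (ler_fst_enorm (grad phi x)).
by apply: le_trans h2; exact: (ler_snd_enorm (grad phi x)).
Qed.

(** The field a + b x has divergence 2 b. *)
Lemma integral_affine_grad U phi (a : R * R) (b : R) : test_fun U phi ->
  \int[leb2]_x dot (a + b *: x) (grad phi x) = - (2 * b * \int[leb2]_x phi x).
Proof.
move=> tphi; have [sphi _] := tphi; have [c0 c1 c2] := test_fun_continuous tphi.
have [K [cK clK KU phi0]] := test_fun_closed_support tphi.
have [d1 d2 _ _] := Ck_S (sphi 1%N).
pose l1 (x : R * R) := b * x.1 + 0 * x.2 + a.1.
pose l2 (x : R * R) := 0 * x.1 + b * x.2 + a.2.
have cl1 n : Ck n l1.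
  apply: (@Ck_comp_affine _
    (fun j t => if j is 0%N then t else if j is 1%N then 1 else 0) b 0 a.1 n 0).
  by case=> [|[|j]] t; [exact: is_derive_id|exact: is_derive_cst|exact: is_derive_cst].
have cl2 n : Ck n l2.
  apply: (@Ck_comp_affine _
    (fun j t => if j is 0%N then t else if j is 1%N then 1 else 0) 0 b a.2 n 0).
  by case=> [|[|j]] t; [exact: is_derive_id|exact: is_derive_cst|exact: is_derive_cst].
have [dl1 _ _ _] := Ck_S (cl1 1%N); have [_ dl2 _ _] := Ck_S (cl2 1%N).
pose u1 x := l1 x * phi x; pose u2 x := l2 x * phi x.
have cu1 : Ck 1 u1 by exact: (CkM (cl1 1%N) (sphi 1%N)).
have cu2 : Ck 1 u2 by exact: (CkM (cl2 1%N) (sphi 1%N)).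
have u10 x : ~ K x -> u1 x = 0 by move=> /phi0; rewrite /u1 => ->; rewrite mulr0.
have u20 x : ~ K x -> u2 x = 0 by move=> /phi0; rewrite /u2 => ->; rewrite mulr0.
have [I1 _] := integral_partial cK cu1 u10; have [_ I2] := integral_partial cK cu2 u20.
have [_ _ cd1 _] := Ck_S cu1; have [_ _ _ cd2] := Ck_S cu2.
have i1 := integrable_compact_support cK (Ck_continuous cd1)
  (fun x => derive_outside_support (1, 0) clK u10).
have i2 := integrable_compact_support cK (Ck_continuous cd2)
  (fun x => derive_outside_support (0, 1) clK u20).
have i0 := integrable_compact_support cK c0 phi0.
have E1 (x : R * R) : 'D_(1, 0) u1 x = l1 x * 'D_(1, 0) phi x + phi x * b.
  have dl : is_derive x (1, 0) l1 b.
    by case: x => s t; apply/is_derive_partial1; exact: is_derive_affine1.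
  by have := is_deriveM dl (d1 x) => /@derive_val; exact.
have E2 (x : R * R) : 'D_(0, 1) u2 x = l2 x * 'D_(0, 1) phi x + phi x * b.
  have dl : is_derive x (0, 1) l2 b.
    by case: x => s t; apply/is_derive_partial2; exact: is_derive_affine2.
  by have := is_deriveM dl (d2 x) => /@derive_val; exact.
transitivity (\int[leb2]_x ('D_(1, 0) u1 x + 'D_(0, 1) u2 x - 2 * b * phi x)).
  apply: eq_Rintegral => x _; rewrite E1 E2 -add_parts//.
  by rewrite /dot /l1 /l2 /= !mul0r addr0 add0r /GRing.scale/= ![_ + a.1]addrC ![_ + a.2]addrC.
rewrite RintegralB//; last 2 first.
- exact: (integrableD measurableT i1 i2).
- exact: (integrableZl measurableT (2 * b) i0).
rewrite RintegralD// RintegralZl//.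
by rewrite /Rintegral I1 I2 /= addr0 sub0r.
Qed.

End test_functions.

(** * Divergence of Raviart-Thomas fields *)

Section raviart_thomas.
Context {R : realType} (D : set (R * R)) (T : mesh R).
Hypotheses (oD : open D) (bD : bounded_set D) (lD : lipschitz_boundary D)
  (triT : triangulation D T).
Implicit Types (k : 'I_(ncells T)) (tau : R * R -> R * R) (d w f : R * R -> R).

Let mD : measurable (D : set (mplane R)).
Proof. exact: open_measurable_plane. Qed.
Let Dfin : (leb2 D < +oo)%E.
Proof. exact: bounded_leb2_fin. Qed.
Let mI k : measurable ((cell k)° : set (mplane R)).
Proof. exact: measurable_interior_cell. Qed.
Let ID k : (cell k)° `<=` D.
Proof. exact: interior_cell_subset. Qed.

Lemma RT0_measurable tau d : RT0 D T tau d ->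
  [/\ measurable_fun D (fst \o tau : mplane R -> R),
      measurable_fun D (snd \o tau : mplane R -> R) &
      leb2.-integrable D (EFin \o d)].
Proof.
case=> -[[t1 t2] dL _] _; split; [exact: inL_mfun t1|exact: inL_mfun t2|].
by apply: inL_integrable dL => //; rewrite ltr1n.
Qed.

Lemma RT0_bounded tau d : RT0 D T tau d ->
  exists2 C, 0 <= C & {ae leb2, forall x : mplane R, D x -> enorm (tau x) <= C}.
Proof.
case=> _ aff; have [a /fin_all_exists[b ab]] := fin_all_exists aff.
pose B k := enorm (a k) + `|b k| * ((\sum_i `|vertex k i|) * 2).
have B0 k : 0 <= B k.
  by rewrite addr_ge0 ?enorm_ge0// !mulr_ge0// sumr_ge0.
exists (\sum_k B k); first exact: sumr_ge0.
have {}ab : {ae leb2, forall x : mplane R, forall k, cell k x -> tau x = a k + b k *: x}.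
  by apply: (filter_forall (leb2_ae_filter R)).
apply: filterS2 (ae_cell oD lD triT) ab => x [Dk _] xab Dx.
have [k kx] := Dk Dx; rewrite (xab k kx) (bigD1 k)//= (le_trans (ler_enormD _ _))// -[leLHS]addr0.
apply: lerD; last exact: sumr_ge0.
rewrite lerD2l enormZ ler_wpM2l// (le_trans (ler_enorm_norm _))//.
by rewrite ler_wpM2r//; exact: (cell_bounded triT).
Qed.

(** Piecewise affine fields are bounded; this allows to pair the discrete fields,
    which are defined through L^2, with fields in L^p for p < 2. *)
Lemma RT0_inLv p tau d : 1 <= p -> RT0 D T tau d -> inLv D p%:E tau.
Proof.
move=> p1 rt; have p0 : 0 < p by exact: lt_le_trans p1.
have [C C0 hC] := RT0_bounded rt; have [m1 m2 _] := RT0_measurable rt.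
by split; apply: (@bounded_inL _ _ mD Dfin _ _ C) => //; apply: filterS hC => x h Dx;
  apply: le_trans (h Dx); [exact: ler_fst_enorm|exact: ler_snd_enorm].
Qed.

Lemma RT0_divergence_test tau d k (a : R * R) (b : R) phi : RT0 D T tau d ->
  {ae leb2, forall x : mplane R, cell k x -> tau x = a + b *: x} ->
  test_fun (cell k)° phi ->
  \int[leb2]_(x in D) (d x * phi x) = 2 * b * \int[leb2]_(x in D) phi x.
Proof.
move=> [[_ _ wd] _] tab tphi; have tD := test_fun_subset oD lD triT tphi.
have := wd phi tD; rewrite /ip => /eqP; rewrite eq_sym eqr_oppLR => /eqP ->.
have outside x : ~ D x -> phi x = 0 /\ grad phi x = (0, 0).
  by move=> nDx; apply: test_fun_outside tphi _ => /ID.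
rewrite (_ : \int[leb2]_(x in D) phi x = \int[leb2]_x phi x); last first.
  rewrite Rintegral_mkcond; apply: eq_Rintegral => x _; rewrite patchE.
  by case: ifPn => // /negP; rewrite inE => /outside[].
rewrite -[RHS]opprK -(integral_affine_grad a b tphi); congr (- _).
rewrite /ipv Rintegral_mkcond; apply: ae_ext_Rintegral.
apply: filterS tab => x h _; rewrite patchE.
have [ix|nix] := pselect ((cell k)° x).
  by rewrite mem_set ?h//; [exact: interior_subset|exact: ID ix].
have [_ ->] := test_fun_outside tphi nix.
by rewrite /dot/= !mulr0 addr0; case: ifP.
Qed.

(** On a triangle where the field is a + b x its weak divergence is 2 b: the test
    functions exhaust the triangle through the cutoffs. *)
Lemma RT0_cell_divergence tau d k (a : R * R) (b : R) w (C : R) : RT0 D T tau d ->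
  {ae leb2, forall x : mplane R, cell k x -> tau x = a + b *: x} ->
  smooth w -> (forall x, `|w x| <= C) ->
  \int[leb2]_(x in (cell k)°) (d x * w x) = 2 * b * \int[leb2]_(x in (cell k)°) w x.
Proof.
move=> rt tab sw wC; have [_ _ id] := RT0_measurable rt.
have mw : measurable_fun setT (w : mplane R -> R).
  by apply: continuous_measurable_plane; exact: Ck_continuous (sw 0%N).
have mwD : measurable_fun D (w : mplane R -> R) by exact: measurable_funTS.
have wCD : {ae leb2, forall x : mplane R, D x -> `|w x| <= C} by apply: aeW.
have iw : leb2.-integrable D (EFin \o w).
  by apply: inL_integrable (bounded_inL mD Dfin (ltr0n _ 2) mwD wCD) => //; rewrite ltr1n.
have idw : leb2.-integrable D (EFin \o (fun x => d x * w x)).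
  exact: bounded_mul_integrable wCD.
have ibw : leb2.-integrable D (EFin \o (fun x => 2 * b * w x)).
  exact: (integrableZl mD (2 * b) iw).
have ih : leb2.-integrable D (EFin \o (fun x => d x * w x - 2 * b * w x)).
  exact: (integrableB mD idw ibw).
have cut n (h : R * R -> R) : leb2.-integrable D (EFin \o h) ->
    leb2.-integrable D (EFin \o (fun x => h x * cutoff (vertex k) n x)).
  move=> hi; apply: (@bounded_mul_integrable _ _ mD h (cutoff (vertex k) n) 1) => //.
    apply: measurable_funTS; apply: continuous_measurable_plane.
    exact: Ck_continuous (smooth_cutoff (vertex k) n 0).
  apply: aeW => x _; have /andP[c0 c1] := cutoff_bounds (vertex k) n x.
  by rewrite ger0_norm.
have zero n : \int[leb2]_(x in D)
    ((d x * w x - 2 * b * w x) * cutoff (vertex k) n x) = 0.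
  under eq_Rintegral do rewrite mulrBl -!mulrA.
  have tn := test_fun_cutoff triT k n sw.
  rewrite RintegralB//; last 2 first.
  - by apply: eq_integrable (cut n _ idw) => // x _; rewrite /= mulrA.
  - by apply: eq_integrable (cut n _ ibw) => // x _; rewrite /= !mulrA.
  rewrite (RT0_divergence_test rt tab tn).
  under [X in _ - X]eq_Rintegral do rewrite mulrA.
  by rewrite RintegralZl ?subrr//; exact: cut.
have := cutoff_integral_eq0 oD lD triT ih zero.
have sub (h : R * R -> R) : leb2.-integrable D (EFin \o h) ->
    leb2.-integrable (cell k)° (EFin \o h).
  by move=> hi; apply: integrableS hi => //; exact: ID.
rewrite RintegralB//; [|exact: sub|exact: sub].
by rewrite RintegralZl//; [move/eqP; rewrite subr_eq0 => /eqP|exact: sub].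
Qed.

End raviart_thomas.

(** * Cell averages *)

Section cell_averages.
Context {R : realType} (D : set (R * R)) (T : mesh R).
Hypotheses (oD : open D) (bD : bounded_set D) (lD : lipschitz_boundary D)
  (triT : triangulation D T).
Implicit Types (k : 'I_(ncells T)) (tau : R * R -> R * R) (d f phi : R * R -> R).

Let mD : measurable (D : set (mplane R)).
Proof. exact: open_measurable_plane. Qed.
Let Dfin : (leb2 D < +oo)%E.
Proof. exact: bounded_leb2_fin. Qed.
Let mI k : measurable ((cell k)° : set (mplane R)).
Proof. exact: measurable_interior_cell. Qed.
Let ID k : (cell k)° `<=` D.
Proof. exact: interior_cell_subset. Qed.

Lemma Qh_cell f : {ae leb2, forall x : mplane R, forall k, cell k x ->
  Qh T f x = cell_mean k f}.
Proof.
apply: filterS (ae_cell oD lD triT) => x [_ kxP] k /kxP[_ ikx _ uk].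
rewrite /Qh (bigD1 k)//= indicE mem_set// mulr1 big1 ?addr0// => j jk.
rewrite indicE memNset ?mulr0// => /interior_subset /uk /eqP.
by rewrite (negbTE jk).
Qed.

Lemma measurable_Qh f : measurable_fun setT (Qh T f : mplane R -> R).
Proof.
by apply: measurable_sum => k; exact: measurable_funM.
Qed.

Lemma Qh_bounded f x : `|Qh T f x| <= \sum_(k < ncells T) `|cell_mean k f|.
Proof.
rewrite /Qh (le_trans (ler_norm_sum _ _ _))//; apply: ler_sum => k _.
rewrite normrM ler_piMr// indicE; case: (_ \in _); by rewrite ?normr1 ?normr0.
Qed.

Lemma Qh_inL p f : 0 < p -> inL D p%:E (Qh T f).
Proof.
move=> p0; apply: (bounded_inL mD Dfin p0 (C := \sum_(k < ncells T) `|cell_mean k f|)).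
  by apply: measurable_funTS; exact: measurable_Qh.
by apply: aeW => x _; exact: Qh_bounded.
Qed.

Lemma null_cell_integral k f : leb2 (cell k) = 0%E ->
  \int[leb2]_(x in (cell k)°) f x = 0.
Proof.
move=> k0; rewrite -(Rintegral_set0 leb2 f) Rintegral_mkcond [RHS]Rintegral_mkcond.
apply: ae_ext_Rintegral; exists (cell k); split => //; first exact: (measurable_cell triT).
move=> x /=; apply: contra_notP => nkx _; rewrite !patchE !memNset//.
by move/interior_subset.
Qed.

Lemma cell_meanM k f :
  cell_mean k f * fine (leb2 (cell k)) = \int[leb2]_(x in (cell k)°) f x.
Proof.
rewrite /cell_mean -(Rintegral_interior_cell oD lD triT k).
have [k0|k0] := eqVneq (leb2 (cell k)) 0%E; first by rewrite null_cell_integral// mulr0 mul0r.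
rewrite mulrAC mulVf ?mul1r// fine_eq0//.
by rewrite ge0_fin_numE//; exact: (leb2_cell_fin triT).
Qed.

Lemma Rintegral_cell_cst k (c : R) :
  \int[leb2]_(x in (cell k)°) c = c * fine (leb2 (cell k)).
Proof. by rewrite Rintegral_cst// (leb2_interior_cell oD lD triT). Qed.

Lemma P0_indicator k : P0 D T (\1_((cell k)°) : R * R -> R).
Proof.
split; first by apply: measurable_funTS; exact: (measurable_indic (mI k)).
move=> j; have [->|jk] := eqVneq j k.
  exists 1; apply: filterS (ae_interior_cell oD lD triT k) => x h /h ikx.
  by rewrite indicE mem_set.
exists 0; apply: filterS (ae_cell oD lD triT) => x [_ kxP] /kxP[_ _ _ uk].
rewrite indicE memNset// => /interior_subset /uk /eqP.
by rewrite eq_sym (negbTE jk).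
Qed.

Lemma ip_indicator k f : ip D f (\1_((cell k)°)) = \int[leb2]_(x in (cell k)°) f x.
Proof.
rewrite /ip [RHS](_ : _ = \int[leb2]_(x in D) (f \_ (cell k)°) x); last first.
  by rewrite -Rintegral_mkcondr (setIidr (@ID k)).
by apply: eq_Rintegral => x _; rewrite indicE patchE; case: (_ \in _);
  rewrite ?mulr1 ?mulr0.
Qed.

Lemma ip_Qh f phi : leb2.-integrable D (EFin \o phi) ->
  ip D (Qh T f) phi = \sum_(k < ncells T) cell_mean k f * \int[leb2]_(x in (cell k)°) phi x.
Proof.
move=> iphi; have iQ : leb2.-integrable D (EFin \o (fun x => Qh T f x * phi x)).
  have QC : {ae leb2, forall x : mplane R, D x ->
      `|Qh T f x| <= \sum_(k < ncells T) `|cell_mean k f|}.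
    by apply: aeW => x _; exact: Qh_bounded.
  have := bounded_mul_integrable mD iphi (measurable_funTS (measurable_Qh f)) QC.
  by apply: eq_integrable => // x _; rewrite /= mulrC.
rewrite /ip (Rintegral_cells oD lD triT iQ); apply: eq_bigr => k _.
rewrite -RintegralZl//; last by apply: integrableS iphi => //; exact: ID.
by apply: ae_ext_Rintegral; apply: filterS (Qh_cell f) => x h /interior_subset /h ->.
Qed.

(** The divergence of the discrete flux is the projection of the data: it is
    constant on each triangle and has there the right mean value. *)
Lemma ip_discrete_divergence tau d f phi : RT0 D T tau d ->
  leb2.-integrable D (EFin \o f) -> (forall v, P0 D T v -> ip D d v = ip D f v) ->
  test_fun D phi -> ip D d phi = ip D (Qh T f) phi.
Proof.
move=> rt if_ mixed tphi; have [_ _ id] := RT0_measurable oD bD rt.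
have [C C0 hC] := test_fun_bounded tphi; have [mphi _ _] := measurable_test_fun tphi.
have phiC x : `|phi x| <= C by have [] := hC x.
have [phiL _] := test_fun_inL mD Dfin (ler1n _ 2) tphi.
have iphi : leb2.-integrable D (EFin \o phi) by apply: inL_integrable phiL => //; rewrite ltr1n.
have phiCD : {ae leb2, forall x : mplane R, D x -> `|phi x| <= C} by apply: aeW.
have idphi := bounded_mul_integrable mD id (measurable_funTS mphi) phiCD.
rewrite ip_Qh// /ip (Rintegral_cells oD lD triT idphi); apply: eq_bigr => k _.
have [_ /(_ k)[a [b tab]]] := rt; have [sphi _] := tphi.
rewrite (RT0_cell_divergence oD bD lD triT rt tab sphi phiC).
have [k0|k0] := eqVneq (leb2 (cell k)) 0%E; first by rewrite null_cell_integral// !mulr0.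
congr (_ * _); have kf : fine (leb2 (cell k)) != 0.
  by rewrite fine_eq0// ge0_fin_numE//; exact: (leb2_cell_fin triT).
apply: (mulIf kf); rewrite cell_meanM -ip_indicator -mixed; last exact: P0_indicator.
rewrite ip_indicator -Rintegral_cell_cst.
have one1 (x : R * R) : `|cst 1 x : R| <= 1 by rewrite normr1.
have := RT0_cell_divergence oD bD lD triT rt tab (fun n => Ck_cst n 1) one1.
under eq_Rintegral do rewrite mulr1.
by rewrite !Rintegral_cell_cst mul1r => ->.
Qed.

End cell_averages.

(** * The negative norm of a divergence *)

Section negative_norm.
Context {R : realType} (D : set (R * R)) (T : mesh R).
Hypotheses (oD : open D) (bD : bounded_set D) (lD : lipschitz_boundary D)
  (triT : triangulation D T).
Implicit Types (k : 'I_(ncells T)) (u f chi phi : R * R -> R)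
  (rho Dchi : R * R -> R * R).

Let mD : measurable (D : set (mplane R)).
Proof. exact: open_measurable_plane. Qed.
Let Dfin : (leb2 D < +oo)%E.
Proof. exact: bounded_leb2_fin. Qed.
Let mI k : measurable ((cell k)° : set (mplane R)).
Proof. exact: measurable_interior_cell. Qed.
Let ID k : (cell k)° `<=` D.
Proof. exact: interior_cell_subset. Qed.

Lemma normL_powR (B : set (R * R)) (q : R) u : 0 < q ->
  (normL B q%:E u `^ q = \int[leb2]_(x in B) (`|u x| `^ q)%:E)%E.
Proof.
move=> q0; rewrite /normL poweR_Lnorm ?gt_eqF// [RHS]integral_mkcond.
apply: eq_integral => x _; rewrite /= !patchE; case: ifP => // _.
by rewrite /= normr0 powR0// gt_eqF.
Qed.

Lemma normL_cells q u : 0 < q -> measurable_fun D (u : mplane R -> R) ->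
  (normL D q%:E u `^ q = \sum_(k < ncells T) normL (cell k)° q%:E u `^ q)%E.
Proof.
move=> q0 mu; rewrite normL_powR// (ge0_integral_cells oD lD triT); last 2 first.
- apply: (@measurableT_comp _ _ _ _ _ _ (fun t => t `^ q) _ (fun x => `|u x|)) => //.
  exact: measurableT_comp.
- by move=> x; exact: powR_ge0.
by apply: eq_bigr => k _; rewrite normL_powR.
Qed.

Lemma inL_cell k q u : 0 < q -> inL D q%:E u -> inL (cell k)° q%:E u.
Proof.
move=> q0 /(inLP mD)[mu fu]; apply/(inLP (mI k)); split.
  by apply: (@measurable_funS _ _ _ _ D) => //; exact: ID.
apply: le_lt_trans fu; apply: le_Lnorm_ae => //; apply: aeW => x.
rewrite !patchE; case: ifPn => [/set_mem/ID Dx|_]; last by rewrite normr0.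
by rewrite mem_set.
Qed.

Lemma W1_cell k q chi Dchi : 0 < q -> W1 D q%:E chi Dchi ->
  W1 (cell k)° q%:E chi Dchi.
Proof.
move=> q0 [c [d1 d2] wg]; split; [exact: inL_cell|by split; exact: inL_cell|].
move=> phi tphi; have tD := test_fun_subset oD lD triT tphi.
have local (F G : R * R -> R) : (forall x, ~ (cell k)° x -> G x = 0) ->
    \int[leb2]_(x in (cell k)°) (F x * G x) = \int[leb2]_(x in D) (F x * G x).
  move=> G0; rewrite Rintegral_mkcond [RHS]Rintegral_mkcond.
  apply: eq_Rintegral => x _; rewrite !patchE; case: ifPn => [/set_mem/ID Dx|].
    by rewrite mem_set.
  by rewrite notin_setE => /G0 ->; rewrite mulr0; case: ifP.
have out x : ~ (cell k)° x -> phi x = 0 /\ grad phi x = (0, 0).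
  exact: test_fun_outside.
have [E1 E2] := wg phi tD.
by rewrite /ip !local ?E1 ?E2// => x /out[h1 h2]; rewrite ?h1 ?h2.
Qed.

(** The local Poincare inequalities add up, because the q-th powers of the norms
    are additive over the triangles. *)
Lemma global_poincare q C chi Dchi : 1 <= q -> poincare_constant T q C ->
  W1 D q%:E chi Dchi ->
  (normL D q%:E (fun x => (chi x - Qh T chi x)%R)
    <= (C * mesh_size T)%:E * normLv D q%:E Dchi)%E.
Proof.
move=> q1 [C0 poinc] wchi; have q0 : 0 < q by exact: lt_le_trans q1.
have [c dc _] := wchi.
have mc : measurable_fun D (chi : mplane R -> R) by exact: inL_mfun c.
have [md1 md2 _] := (inLvP mD Dchi q1).1 dc.
have Ch0 : 0 <= C * mesh_size T by rewrite mulr_ge0// mesh_size_ge0.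
suff : (normL D q%:E (fun x => (chi x - Qh T chi x)%R) `^ q <=
    ((C * mesh_size T)%:E * normLv D q%:E Dchi) `^ q)%E.
  have root (x : \bar R) : (0 <= x -> (x `^ q) `^ q^-1 = x)%E.
    by move=> x0; rewrite -poweRrM mulfV ?gt_eqF// poweRe1.
  move=> h; rewrite -[leLHS]root ?normL_ge0// -[leRHS]root; last first.
    by rewrite mule_ge0 ?normLv_ge0.
  by apply: gt0_ler_poweR h; rewrite ?invr_ge0 ?(ltW q0)// in_itv/= leey andbT poweR_ge0.
rewrite normL_cells//; last first.
  apply: measurable_funB => //; apply: measurable_funTS.
  exact: measurable_Qh.
rewrite poweRM ?normLv_ge0// /normLv normL_cells//; last exact: measurable_enorm.
rewrite ge0_sume_distrr; last by move=> k _; exact: poweR_ge0.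
apply: lee_sum => k _; rewrite -poweRM ?normL_ge0//.
apply: gt0_ler_poweR; rewrite ?(ltW q0)// ?in_itv/= ?leey ?andbT ?mule_ge0 ?normL_ge0//.
apply: le_trans (poinc k chi Dchi (W1_cell k q0 wchi)) _.
by apply: lee_wpmul2r; rewrite ?normLv_ge0// lee_fin ler_wpM2l// diam_mesh_size.
Qed.

(** Q_h preserves the integral over each triangle. *)
Lemma ip_Qh_orthogonal f chi : leb2.-integrable D (EFin \o f) ->
  ip D (fun x => f x - Qh T f x) (Qh T chi) = 0.
Proof.
move=> if_.
have iQ : leb2.-integrable D (EFin \o Qh T f).
  have QL : inL D 2%:E (Qh T f) by exact: Qh_inL.
  by apply: inL_integrable QL => //; rewrite ltr1n.
have iF : leb2.-integrable D (EFin \o (fun x => f x - Qh T f x)).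
  exact: (integrableB mD if_ iQ).
have -> : ip D (fun x => f x - Qh T f x) (Qh T chi) =
    ip D (Qh T chi) (fun x => f x - Qh T f x).
  by apply: eq_Rintegral => x _; rewrite mulrC.
rewrite (ip_Qh oD lD triT)// big1// => k _.
have sub (h : R * R -> R) : leb2.-integrable D (EFin \o h) ->
    leb2.-integrable (cell k)° (EFin \o h).
  by move=> hi; apply: integrableS hi => //; exact: ID.
rewrite RintegralB//; [|exact: sub|exact: sub].
rewrite -(cell_meanM oD lD triT k f).
rewrite [X in _ - X](_ : _ = \int[leb2]_(x in (cell k)°) cell_mean k f).
  by rewrite (Rintegral_cell_cst oD lD triT) subrr mulr0.
by apply: ae_ext_Rintegral; apply: filterS (Qh_cell oD lD triT f) => x h /interior_subset /h.
Qed.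

Variables (p q : R).
Hypotheses (p1 : 1 <= p) (q1 : 1 <= q) (pq : p^-1 + q^-1 = 1).

Let p0 : 0 < p. Proof. exact: lt_le_trans p1. Qed.
Let q0 : 0 < q. Proof. exact: lt_le_trans q1. Qed.

Lemma ipvB rho (v w : R * R -> R * R) : inLv D p%:E rho -> inLv D q%:E v -> inLv D q%:E w ->
  ipv D rho (fun x => v x - w x) = ipv D rho v - ipv D rho w.
Proof.
move=> hr hv hw; rewrite /ipv -RintegralB//; [|exact: (hoelder_integrable_dot mD p0 q0 pq)..].
by apply: eq_Rintegral => x _; rewrite /dot/=; ring.
Qed.

Lemma ipB f (v w : R * R -> R) : inL D p%:E f -> inL D q%:E v -> inL D q%:E w ->
  ip D f (fun x => v x - w x) = ip D f v - ip D f w.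
Proof.
move=> hr hv hw; rewrite /ip -RintegralB//; [|exact: (hoelder_integrable mD p0 q0 pq)..].
by apply: eq_Rintegral => x _; rewrite mulrBr.
Qed.

Lemma inLB (e : R) (v w : R * R -> R) : 1 <= e -> inL D e%:E v -> inL D e%:E w ->
  inL D e%:E (fun x => v x - w x).
Proof.
move=> e1 /(inLP mD)[mv fv] /(inLP mD)[mw fw]; apply/(inLP mD); split.
  exact: measurable_funB.
have mNw : measurable_fun D ((fun x => - w x) : mplane R -> R) by exact: measurableT_comp.
apply: le_lt_trans (normLD mD e1 mv mNw) _; apply: lte_add_pinfty => //.
by rewrite -normL_normr (_ : (fun x => `|- w x|) = (fun x => `|w x|)) ?normL_normr//;
  apply/funext => x; rewrite normrN.
Qed.

Lemma inLvB (e : R) (v w : R * R -> R * R) : 1 <= e -> inLv D e%:E v -> inLv D e%:E w ->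
  inLv D e%:E (fun x => v x - w x).
Proof. by move=> e1 [a1 a2] [b1 b2]; split; exact: inLB. Qed.

(** An identity that holds for test functions extends to W_0^{1,q} by density. *)
Lemma weak_div_W10 rho f chi Dchi : inLv D p%:E rho -> inL D p%:E f ->
  (forall phi, test_fun D phi -> ipv D rho (grad phi) = - ip D f phi) ->
  W10 D q%:E chi Dchi -> ipv D rho Dchi = - ip D f chi.
Proof.
move=> rhoL fL wdiv [[chiL DchiL _] [phi [tphi [cphi cgrad]]]].
pose A := normLv D p%:E rho; pose B := normL D p%:E f.
have finA : A \is a fin_num.
  by have [_ _ h] := (inLvP mD rho p1).1 rhoL; rewrite ge0_fin_numE// normLv_ge0.
have finB : B \is a fin_num.
  by have [_ h] := (inLP mD _ f).1 fL; rewrite ge0_fin_numE// normL_ge0.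
have lim := cvgeD _ (cvgeZl finA cgrad) (cvgeZl finB cphi).
rewrite !mule0 adde0 in lim.
have bound : forall n, (`|ipv D rho Dchi + ip D f chi|%:E <=
    A * normLv D q%:E (fun x => (Dchi x - grad (phi n) x)%R) +
    B * normL D q%:E (fun x => (chi x - phi n x)%R))%E.
  move=> n; have [pL gL] := test_fun_inL mD Dfin q1 (tphi n).
  have -> : ipv D rho Dchi + ip D f chi =
      ipv D rho (fun x => Dchi x - grad (phi n) x) + ip D f (fun x => chi x - phi n x).
    by rewrite ipvB// ipB// wdiv// opprK addrACA subrr addr0.
  have hB := hoelder_ip mD p0 q0 pq fL (inLB q1 chiL pL).
  have hA := hoelder_ipv mD p1 q1 pq rhoL (inLvB q1 DchiL gL).
  apply: le_trans (leeD hA hB); rewrite -EFinD lee_fin; exact: ler_normD.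
suff : (`|ipv D rho Dchi + ip D f chi|%:E <= 0)%E.
  by rewrite lee_fin normr_le0 addr_eq0 => /eqP.
by apply: cvge_ge (lim _ _) => //; exact: nearW.
Qed.

(** The divergence of rho acts on chi as the integral of (f - Q_h f) chi. The cell
    means of chi can be subtracted there, as f - Q_h f is orthogonal to piecewise
    constants; then the Hoelder and Poincare inequalities give the factor h. *)
Lemma norm_divW_le C rho f : poincare_constant T q C -> inLv D p%:E rho ->
  inL D p%:E f -> leb2.-integrable D (EFin \o f) ->
  (forall phi, test_fun D phi ->
    ipv D rho (grad phi) = - ip D (fun x => f x - Qh T f x) phi) ->
  (norm_divW D q rho <=
    (C * mesh_size T)%:E * normL D p%:E (fun x => (f x - Qh T f x)%R))%E.
Proof.
move=> poinc rhoL fL if_ wdiv; have [C0 _] := poinc.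
have Ch0 : 0 <= C * mesh_size T by rewrite mulr_ge0// mesh_size_ge0.
have FL : inL D p%:E (fun x => f x - Qh T f x) by apply: inLB => //; exact: Qh_inL.
apply: ge_ereal_sup => _ [chi [Dchi [chi0 _ ->]]].
have [wchi _] := chi0; have [chiL DchiL _] := wchi.
have chiQL : inL D q%:E (Qh T chi) by exact: Qh_inL.
rewrite (weak_div_W10 rhoL FL wdiv chi0) opprK.
set N := fine (normLv D q%:E Dchi).
have NE : normLv D q%:E Dchi = N%:E.
  by have [_ _ h] := (inLvP mD Dchi q1).1 DchiL; rewrite /N fineK// ge0_fin_numE// normLv_ge0.
have N0 : 0 <= N by rewrite fine_ge0// normLv_ge0.
have rhs0 : (0 <= (C * mesh_size T)%:E * normL D p%:E (fun x => (f x - Qh T f x)%R))%E.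
  by rewrite mule_ge0 ?normL_ge0.
have [->|Nn0] := eqVneq N 0; first by rewrite invr0 mulr0.
have Np : 0 < N by rewrite lt_neqAle eq_sym Nn0.
rewrite EFinM lee_pdivrMr//.
have -> : ip D (fun x => f x - Qh T f x) chi =
    ip D (fun x => f x - Qh T f x) (fun x => chi x - Qh T chi x).
  by rewrite ipB// ip_Qh_orthogonal// subr0.
apply: le_trans (_ : _ <= normL D p%:E (fun x => (f x - Qh T f x)%R) *
  normL D q%:E (fun x => (chi x - Qh T chi x)%R))%E _.
  apply: le_trans (hoelder_ip mD p0 q0 pq FL (inLB q1 chiL chiQL)).
  by rewrite lee_fin ler_norm.
rewrite muleAC [leRHS]muleC; apply: lee_wpmul2l; first exact: normL_ge0.
by rewrite -NE; exact: global_poincare.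
Qed.

End negative_norm.

(** * Elliptic matrices *)

Section matrix_fields.
Context {R : realType}.
Implicit Types (M N : 'M[R]_2) (v w : R * R).

Let ord_max2 : (ord_max : 'I_2) = lift ord0 ord0.
Proof. exact: val_inj. Qed.

Lemma mxapp_mulmx M N v : mxapp (M *m N) v = mxapp M (mxapp N v).
Proof.
rewrite /mxapp !mxE !big_ord_recl !big_ord0 !addr0 ord_max2 /=.
by congr (_, _); ring.
Qed.

Lemma mxapp1 v : mxapp 1%:M v = v.
Proof.
rewrite /mxapp !mxE /= mul1r mul0r mul0r mul1r addr0 add0r.
by rewrite -surjective_pairing.
Qed.

Lemma mxappB M v w : mxapp M (v - w) = mxapp M v - mxapp M w.
Proof. by rewrite /mxapp/= [RHS]surjective_pairing/=; congr (_, _); ring. Qed.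

Lemma elliptic_unitmx M (alpha : R) : 0 < alpha ->
  (forall xi : R * R, alpha * enorm xi ^+ 2 <= dot xi (mxapp M xi)) -> M \in unitmx.
Proof.
move=> a0 ell; rewrite unitmxE unitfE; apply/negP => /det0P[z z0 zM].
pose xi : R * R := (z ord0 ord0, z ord0 ord_max).
have row j : z ord0 ord0 * M ord0 j + z ord0 ord_max * M ord_max j = 0.
  have := congr1 (fun r : 'rV_2 => r ord0 j) zM.
  by rewrite !mxE !big_ord_recl big_ord0 addr0 ord_max2.
have := ell xi; rewrite (_ : dot xi _ = 0); last first.
  rewrite /dot /mxapp /xi /=.
  transitivity ((z ord0 ord0 * M ord0 ord0 + z ord0 ord_max * M ord_max ord0) * z ord0 ord0 +
    (z ord0 ord0 * M ord0 ord_max + z ord0 ord_max * M ord_max ord_max) * z ord0 ord_max).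
    ring.
  by rewrite !row !mul0r addr0.
rewrite pmulr_rle0// sqr_enorm => le0.
have : dot xi xi = 0 by apply/eqP; rewrite eq_le le0 dotxx_ge0.
move=> /eqP; rewrite /dot paddr_eq0 -?expr2 ?sqr_ge0// !sqrf_eq0 => /andP[/eqP x0 /eqP x1].
apply/negP: z0; rewrite negbK; apply/eqP/rowP => j; rewrite mxE.
case: j => [[|[|//]] lt]; [rewrite -[RHS]x0|rewrite -[RHS]x1];
  by congr (z _ _); exact: val_inj.
Qed.

(** Ellipticity is tested with w = M^-1 v: alpha |w|^2 <= w . v <= |w| |v|. *)
Lemma enorm_invmx_le M (alpha : R) v : 0 < alpha ->
  (forall xi : R * R, alpha * enorm xi ^+ 2 <= dot xi (mxapp M xi)) ->
  enorm (mxapp (invmx M) v) <= alpha^-1 * enorm v.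
Proof.
move=> a0 ell; have uM := elliptic_unitmx a0 ell.
set w := mxapp _ v; have [w0|w0] := eqVneq (enorm w) 0.
  by rewrite w0 mulr_ge0 ?enorm_ge0// invr_ge0 ltW.
have wp : 0 < enorm w by rewrite lt_neqAle eq_sym w0 enorm_ge0.
have := ell w; rewrite -mxapp_mulmx mulmxV// mxapp1 => h.
have := le_trans h (le_trans (ler_norm _) (cauchy_schwarz w v)).
by rewrite expr2 mulrCA ler_pM2l// ler_pdivlMl.
Qed.

Let entry_bound (a b c beta alpha : R) : 0 < alpha ->
  alpha <= a -> a <= beta -> alpha <= c -> c <= beta ->
  alpha * 2 <= a + b + (b + c) -> a + b + (b + c) <= beta * 2 -> `|b| <= beta.
Proof. by move=> *; rewrite ler_norml; lra. Qed.

(** The entries of a symmetric matrix are combinations of the values of its quadratic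
    form at (1, 0), (0, 1) and (1, 1). *)
Lemma symmetric_entries_bound M (alpha beta : R) i j : 0 < alpha -> M^T = M ->
  (forall xi : R * R, alpha * enorm xi ^+ 2 <= dot xi (mxapp M xi) /\
    dot xi (mxapp M xi) <= beta * enorm xi ^+ 2) ->
  `|M i j| <= beta.
Proof.
move=> a0 sM ell.
have sym : M ord_max ord0 = M ord0 ord_max by rewrite -[in LHS]sM mxE.
have := ell (1, 0); have := ell (0, 1); have := ell (1, 1).
rewrite !sqr_enorm /dot /mxapp /= !mul1r !mulr1 !mul0r !mulr0 !addr0 !add0r !mulr1 sym.
rewrite -mulr2n => -[l11 u11] [l2 u2] [l1 u1].
have b01 : `|M ord0 ord_max| <= beta.
  by apply: entry_bound a0 l1 u1 l2 u2 _ _.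
have pos t : alpha <= t -> t <= beta -> `|t| <= beta.
  by move=> h1 h2; rewrite ger0_norm// (le_trans (ltW a0)).
have i2 (l : 'I_2) : l = ord0 \/ l = ord_max.
  by case: l => [[|[|//]] lt]; [left|right]; exact: val_inj.
by case: (i2 i) => ->; case: (i2 j) => ->; rewrite ?sym//; exact: pos.
Qed.

Lemma enorm_mxapp_le M (beta : R) v : (forall i j, `|M i j| <= beta) ->
  enorm (mxapp M v) <= 4 * beta * enorm v.
Proof.
move=> Mb; have b0 : 0 <= beta by exact: le_trans (normr_ge0 _) (Mb ord0 ord0).
have e i j (t : R) : `|t| <= enorm v -> `|M i j * t| <= beta * enorm v.
  by move=> h; rewrite normrM ler_pM.
have h1 := ler_fst_enorm v; have h2 := ler_snd_enorm v.
apply: le_trans (enorm_ler_sum _) _; rewrite /mxapp /=.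
have -> : 4 * beta * enorm v = (beta * enorm v + beta * enorm v) +
  (beta * enorm v + beta * enorm v) by ring.
by apply: lerD; apply: le_trans (ler_normD _ _) _; apply: lerD; exact: e.
Qed.

Variables (d : measure_display) (S : measurableType d) (D : set S).
Hypothesis mD : measurable D.

Lemma measurable_det n (B : S -> 'M[R]_n) :
  (forall i j, measurable_fun D (fun x => B x i j)) ->
  measurable_fun D (fun x => \det (B x)).
Proof.
move=> mB; apply: measurable_sum => s; apply: measurable_funM => //.
by apply: measurable_prod => i _.
Qed.

Lemma measurable_invmx n (B : S -> 'M[R]_n) i j :
  (forall i j, measurable_fun D (fun x => B x i j)) ->
  measurable_fun D (fun x => invmx (B x) i j).
Proof.
move=> mB; have mdet := measurable_det mB.
rewrite (_ : (fun x => _) = (fun x => if \det (B x) == 0 then B x i j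
    else (\det (B x))^-1 * cofactor (B x) j i)); last first.
  apply/funext => x; rewrite /invmx unitmxE unitfE.
  by case: eqVneq => //= _; rewrite !mxE.
apply: measurable_fun_if => //.
- exact: measurable_fun_eqr.
- by apply: measurable_funS (mB i j) => //; exact: subIsetl.
apply: (@measurable_funS _ _ _ _ D) => //.
apply: measurable_funM; first exact: (measurableT_comp measurable_inv mdet).
apply: measurable_funM => //; apply: measurable_det => k l.
by rewrite (_ : (fun x => _) = (fun x => B x (lift j k) (lift i l)))//;
  apply/funext => x; rewrite !mxE.
Qed.

End matrix_fields.

(** * The coefficient and the singular field *)

Section coefficient_fields.
Context {R : realType} (D : set (R * R)).
Hypotheses (oD : open D).
Implicit Types (v w tau : R * R -> R * R) (u phi : R * R -> R) (A : R * R -> 'M[R]_2).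

Let mD : measurable (D : set (mplane R)).
Proof. exact: open_measurable_plane. Qed.

Local Notation mfun u := (measurable_fun (D : set (mplane R)) (u : mplane R -> R)).

Lemma inLv_dominated p (c : R) v w : 1 <= p -> mfun (fst \o w) -> mfun (snd \o w) ->
  {ae leb2, forall x : mplane R, D x -> enorm (w x) <= c * enorm (v x)} ->
  inLv D p%:E v -> inLv D p%:E w.
Proof.
move=> p1 m1 m2 wv vL; have p0 : 0 < p by exact: lt_le_trans p1.
apply/(inLvP mD) => //; split => //.
have cL : inL D p%:E (fun x => enorm (v x) * c).
  have := Lfun_scale c p1 (inL_enorm mD p1 vL); rewrite /inL.
  rewrite (_ : c \o* _ = (fun x : mplane R => enorm (v x) * c) \_ D)//.
  by apply/funext => x; rewrite /= !patchE; case: ifP => //=; rewrite mul0r.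
have [_] := (inLP mD _ _).1 cL; apply: le_lt_trans.
apply: le_normL => //; apply: filterS wv => x h Dx.
by rewrite /= (ger0_norm (enorm_ge0 _)) mulrC (le_trans (h Dx)) ?ler_norm.
Qed.

Lemma measurable_mxapp (B : R * R -> 'M[R]_2) v : (forall i j, mfun (fun x => B x i j)) ->
  mfun (fst \o v) -> mfun (snd \o v) ->
  mfun (fun x => (mxapp (B x) (v x)).1) /\ mfun (fun x => (mxapp (B x) (v x)).2).
Proof.
by move=> mB m1 m2; split; apply: measurable_funD; apply: measurable_funM => //; exact: mB.
Qed.

Section admissible.
Variables (A : R * R -> 'M[R]_2) (alpha beta : R).
Hypotheses (a0 : 0 < alpha) (adm : admissible_coefficient D A alpha beta).

Let mA i j : mfun (fun x => A x i j).
Proof. by have [h _ _] := adm; exact: inL_mfun (h i j). Qed.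

Lemma inLv_Aapp p v : 1 <= p -> inLv D p%:E v -> inLv D p%:E (Aapp A v).
Proof.
move=> p1 vL; have [m1 m2 _] := (inLvP mD v p1).1 vL.
have [w1 w2] := measurable_mxapp mA m1 m2.
have [_ sym ell] := adm.
apply: (inLv_dominated (c := 4 * beta) p1 w1 w2 _ vL).
apply: filterS2 sym ell => x sx ex Dx; apply: enorm_mxapp_le => i j.
exact: symmetric_entries_bound a0 (sx Dx) (ex Dx).
Qed.

Lemma inLv_Ainv p v : 1 <= p -> inLv D p%:E v -> inLv D p%:E (Ainv A v).
Proof.
move=> p1 vL; have [m1 m2 _] := (inLvP mD v p1).1 vL.
have mI i j : mfun (fun x => invmx (A x) i j) by exact: measurable_invmx.
have [w1 w2] := measurable_mxapp mI m1 m2.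
have [_ _ ell] := adm.
apply: (inLv_dominated (c := alpha^-1) p1 w1 w2 _ vL).
apply: filterS ell => x ex Dx; apply: enorm_invmx_le => // xi.
by have [] := ex Dx xi.
Qed.

Lemma Ainv_Aapp v :
  {ae leb2, forall x : mplane R, D x -> Ainv A (Aapp A v) x = v x}.
Proof.
have [_ _ ell] := adm; apply: filterS ell => x ex Dx.
rewrite /Ainv /Aapp -mxapp_mulmx mulVmx ?mxapp1//.
by apply: (elliptic_unitmx a0) => xi; have [] := ex Dx xi.
Qed.

End admissible.

Lemma measurable_f2 (x0 : R * R) : mfun (fst \o f2 x0) /\ mfun (snd \o f2 x0).
Proof.
have mX1 : mfun (fun x => (x - x0).1) by apply: measurable_funB => //; exact: measurable_funTS.
have mX2 : mfun (fun x => (x - x0).2) by apply: measurable_funB => //; exact: measurable_funTS.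
have mI : mfun (fun x => (enorm (x - x0) ^+ 2)^-1).
  apply: (measurableT_comp measurable_inv); apply: measurable_funX.
  exact: (@measurable_enorm _ _ (mplane R) D (fun x : mplane R => (x : R * R) - x0) mX1 mX2).
by split; apply: measurable_funM => //; exact: measurable_funM.
Qed.

Lemma ipvC v w : ipv D v w = ipv D w v.
Proof. by apply: eq_Rintegral => x _; rewrite /dot; ring. Qed.

Lemma ipvBl p q v1 v2 w : 1 <= p -> 1 <= q -> p^-1 + q^-1 = 1 ->
  inLv D p%:E v1 -> inLv D p%:E v2 -> inLv D q%:E w ->
  ipv D (fun x => v1 x - v2 x) w = ipv D v1 w - ipv D v2 w.
Proof.
move=> p1 q1 pq h1 h2 h3; have qp : q^-1 + p^-1 = 1 by rewrite addrC.
by rewrite ipvC (ipvB oD q1 p1 qp)//; congr (_ - _); exact: ipvC.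
Qed.

Lemma eq_ae_ipv v1 v2 w : {ae leb2, forall x : mplane R, D x -> v1 x = v2 x} ->
  ipv D v1 w = ipv D v2 w.
Proof. by move=> e; apply: ae_ext_Rintegral; apply: filterS e => x h /h ->. Qed.

Lemma integrable_extend0 (F : R * R -> R) : leb2.-integrable D (EFin \o F) ->
  (forall x, ~ D x -> F x = 0) -> leb2.-integrable setT (EFin \o F).
Proof.
move=> /(integrable_mkcond _ mD) iF F0; apply: eq_integrable iF => // x _.
by rewrite patchE; case: ifPn => //; rewrite notin_setE => /F0 /= ->.
Qed.

(** The point mass of integral_point_source, with the factor 1/(2 pi) and with phi
    extended by zero to the plane. *)
Lemma ipv_f2_grad p q (x0 : R * R) phi : 1 <= p -> 1 <= q -> p^-1 + q^-1 = 1 ->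
  (leb2 D < +oo)%E ->
  inLv D p%:E (f2 x0) -> test_fun D phi -> ipv D (f2 x0) (grad phi) = - phi x0.
Proof.
move=> p1 q1 pq Dfin f2L tphi.
have p0 : 0 < p by exact: lt_le_trans p1.
have q0 : 0 < q by exact: lt_le_trans q1.
have [_ [g1 g2]] := test_fun_inL mD Dfin q1 tphi.
have [fL1 fL2] := f2L.
have pi0 : 2 * pi != 0 :> R by rewrite mulf_neq0 ?gt_eqF ?pi_gt0.
have out x : ~ D x -> phi x = 0 /\ grad phi x = (0, 0) by exact: test_fun_outside.
have i1 := hoelder_integrable mD p0 q0 pq fL1 g1.
have i2 := hoelder_integrable mD p0 q0 pq fL2 g2.
have j1 : leb2.-integrable setT (EFin \o (fun x : R * R => (fst \o f2 x0) x * (fst \o grad phi) x)).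
  by apply: integrable_extend0 => // x /out[_] /= -[-> _]; rewrite mulr0.
have j2 : leb2.-integrable setT (EFin \o (fun x : R * R => (snd \o f2 x0) x * (snd \o grad phi) x)).
  by apply: integrable_extend0 => // x /out[_] /= -[_ ->]; rewrite mulr0.
have E1 (x : R * R) : (x.1 - x0.1) / ((x.1 - x0.1) ^+ 2 + (x.2 - x0.2) ^+ 2) *
    'D_(1, 0) phi x = 2 * pi * ((fst \o f2 x0) x * (fst \o grad phi) x).
  rewrite /= /f2 sqr_enorm /dot /= !mulrA divff// mul1r.
  by rewrite !expr2 [_ / _]mulrC.
have E2 (x : R * R) : (x.2 - x0.2) / ((x.2 - x0.2) ^+ 2 + (x.1 - x0.1) ^+ 2) *
    'D_(0, 1) phi x = 2 * pi * ((snd \o f2 x0) x * (snd \o grad phi) x).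
  rewrite /= /f2 sqr_enorm /dot /= !mulrA divff// mul1r.
  by rewrite !expr2 [_ / _]mulrC [X in X^-1]addrC.
have [K [cK _ KD phi0]] := test_fun_closed_support tphi.
have k1 := integrableZl measurableT (2 * pi) j1.
have k2 := integrableZl measurableT (2 * pi) j2.
have := @integral_point_source R phi K x0 (tphi.1 2%N) cK phi0.
case/(_ _ _)/Wrap => [||/(congr1 fine) /= h].
- by apply: eq_integrable k1 => // x _; rewrite /= E1.
- by apply: eq_integrable k2 => // x _; rewrite /= E2.
have {h} : \int[leb2]_x (2 * pi * ((fst \o f2 x0) x * (fst \o grad phi) x) +
    2 * pi * ((snd \o f2 x0) x * (snd \o grad phi) x)) = - (2 * pi) * phi x0.
  by rewrite -h; apply: eq_Rintegral => x _; rewrite E1 E2.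
under eq_Rintegral do rewrite -mulrDr.
rewrite RintegralZl//; last by have := integrableD measurableT j1 j2; exact: eq_integrable.
rewrite mulNr -mulrN => /(mulfI pi0) <-.
rewrite /ipv Rintegral_mkcond; apply: eq_Rintegral => x _; rewrite patchE.
case: ifPn => //; rewrite notin_setE => /out[_ /= [-> ->]].
by rewrite !mulr0 addr0.
Qed.

End coefficient_fields.

(** * Quasi-optimality of the flux *)

Section error_estimate.
Context {R : realType} (D : set (R * R)) (T : mesh R).
Hypotheses (oD : open D) (bD : bounded_set D) (lD : lipschitz_boundary D)
  (triT : triangulation D T).
Variables (p q alpha beta : R) (A : R * R -> 'M[R]_2).
Hypotheses (p1 : 1 < p) (q1 : 1 <= q) (pq : p^-1 + q^-1 = 1) (a0 : 0 < alpha)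
  (adm : admissible_coefficient D A alpha beta).
Variables (ds : {measure set (mplane R) -> \bar R}) (x0 : R * R) (f1 g : R * R -> R)
  (u : R * R -> R) (Du : R * R -> R * R) (sigmah : R * R -> R * R) (uh : R * R -> R).
Hypotheses (f1L : inL D p%:E f1) (u_sol : weak_solution D ds p A x0 f1 g u Du)
  (h_sol : mixed_solution D ds p T A x0 f1 g sigmah uh).
Implicit Types (tau : R * R -> R * R) (phi : R * R -> R).

Let mD : measurable (D : set (mplane R)).
Proof. exact: open_measurable_plane. Qed.
Let Dfin : (leb2 D < +oo)%E.
Proof. exact: bounded_leb2_fin. Qed.
Let p1' : 1 <= p. Proof. exact: ltW. Qed.
Let DuL : inLv D p%:E Du. Proof. by have [[]] := u_sol. Qed.
Let ADuL : inLv D p%:E (Aapp A Du). Proof. exact: (inLv_Aapp oD a0 adm p1' DuL). Qed.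
Let f1i : leb2.-integrable D (EFin \o f1). Proof. exact: inL_integrable p1 f1L. Qed.

Let sigma := modified_flux A x0 Du.

Lemma measurable_modified_flux :
  measurable_fun D (fst \o sigma : mplane R -> R) /\
  measurable_fun D (snd \o sigma : mplane R -> R).
Proof.
have [m1 m2 _] := (inLvP mD _ p1').1 ADuL; have [n1 n2] := measurable_f2 D x0.
split.
  rewrite (_ : fst \o sigma = (fun x => - (fst \o Aapp A Du) x - (fst \o f2 x0) x))//.
  by apply: measurable_funB => //; exact: measurableT_comp.
rewrite (_ : snd \o sigma = (fun x => - (snd \o Aapp A Du) x - (snd \o f2 x0) x))//.
by apply: measurable_funB => //; exact: measurableT_comp.
Qed.

Lemma inLvN v : inLv D p%:E v -> inLv D p%:E (fun x => - v x).
Proof.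
move=> /(inLvP mD _ p1')[m1 m2 f]; apply/(inLvP mD _ p1').
rewrite normLvN; split=> //.
  by rewrite (_ : fst \o _ = (fun x => - (fst \o v) x))//; exact: measurableT_comp.
by rewrite (_ : snd \o _ = (fun x => - (snd \o v) x))//; exact: measurableT_comp.
Qed.

Lemma ipvNl v w : inLv D p%:E v -> inLv D q%:E w ->
  ipv D (fun x => - v x) w = - ipv D v w.
Proof.
move=> vL wL; rewrite -mulN1r -RintegralZl//; last first.
  by apply: (hoelder_integrable_dot mD _ _ pq) vL wL;
    [exact: lt_le_trans p1'|exact: lt_le_trans q1].
by apply: eq_Rintegral => x _; rewrite /dot /=; ring.
Qed.

Lemma ip0l w : ip D (cst 0) w = 0.
Proof.
rewrite /ip (_ : (fun x => _) = cst 0); last by apply/funext => x; rewrite /= mul0r.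
by rewrite Rintegral_cst// mul0r.
Qed.

Section competitor.
Variable tau : R * R -> R * R.
Hypotheses (tau_f1 : RT0f D T f1 tau) (rhoL : inLv D p%:E (fun x => sigma x - tau x)).

Let tauL : inLv D p%:E tau. Proof. exact: (RT0_inLv oD bD lD triT p1' tau_f1). Qed.

(** The singular field inherits its integrability from the flux error, as it is
    - A grad u - tau - (sigma - tau). *)
Let f2L : inLv D p%:E (f2 x0).
Proof.
have := inLvB oD p1' (inLvB oD p1' (inLvN ADuL) tauL) rhoL.
congr inLv; apply/funext => x; rewrite /sigma /modified_flux.
by rewrite opprB addrA subrK opprB addrC subrK.
Qed.

Lemma ipv_flux_error w : inLv D q%:E w ->
  ipv D (fun x => sigma x - tau x) w =
  - ipv D (Aapp A Du) w - ipv D (f2 x0) w - ipv D tau w.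
Proof.
move=> wL; rewrite (ipvBl oD p1' q1 pq _ tauL wL); last first.
  exact: (inLvB oD p1' (inLvN ADuL) f2L).
by rewrite (ipvBl oD p1' q1 pq (inLvN ADuL) f2L wL) ipvNl.
Qed.

(** The point source in the equation for u is cancelled by the divergence of the
    singular field, so that the flux error sees the load without its cell means. *)
Lemma flux_error_divergence phi : test_fun D phi ->
  ipv D (fun x => sigma x - tau x) (grad phi) = - ip D (fun x => f1 x - Qh T f1 x) phi.
Proof.
move=> tphi; have [phiL gL] := test_fun_inL mD Dfin q1 tphi.
have [_ _ /(_ phi tphi) ws] := u_sol; have [[_ _ /(_ phi tphi) wt] _] := tau_f1.
rewrite ipv_flux_error// ws wt (ipv_f2_grad oD p1' q1 pq Dfin f2L tphi).
have QL : inL D p%:E (Qh T f1) by apply: Qh_inL => //; exact: lt_le_trans p1'.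
rewrite /ip; under [in RHS]eq_Rintegral do rewrite mulrBl.
rewrite RintegralB//; [by rewrite -!/(ip _ _ _); lra| |].
- by apply: (hoelder_integrable mD _ _ pq) f1L phiL;
    [exact: lt_le_trans p1'|exact: lt_le_trans q1].
- by apply: (hoelder_integrable mD _ _ pq) QL phiL;
    [exact: lt_le_trans p1'|exact: lt_le_trans q1].
Qed.

(** Against a divergence-free discrete field the boundary term of the mixed equation
    is its pairing with grad u, so that the exact flux satisfies the same equation
    as the discrete one. *)
Lemma discrete_error_is_Rh :
  is_Rh D T A (fun x => sigma x - tau x) (fun x => sigmah x - tau x).
Proof.
have [dsh [rtsh _ mixed1 mixed2]] := h_sol.
have [[sh2 dsh2 wsh] affsh] := rtsh; have [[tau2 _ wtau] afftau] := tau_f1.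
have two : 1 <= 2 :> R by rewrite ler1n.
have half : 2^-1 + 2^-1 = 1 :> R by field.
split.
  split; [split|].
  - exact: inLvB.
  - by apply: (@bounded_inL _ _ mD Dfin _ _ 0) => //; apply: aeW => x _; rewrite normr0.
  - move=> phi tphi; have [_ gL] := test_fun_inL mD Dfin two tphi.
    rewrite (ipvBl oD two two half sh2 tau2 gL) wsh// wtau// ip0l oppr0.
    by rewrite (ip_discrete_divergence oD bD lD triT rtsh f1i mixed2 tphi) subrr.
  - move=> k; have [a [b hab]] := affsh k; have [a' [b' hab']] := afftau k.
    exists (a - a'), (b - b'); apply: filterS2 hab hab' => x h h' kx.
    by rewrite h// h'// scalerBl opprD addrACA.
move=> k kK; have kL : inLv D q%:E k by exact: (RT0_inLv oD bD lD triT q1 kK).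
(* The solution u extends g and so evaluates the boundary term. *)
have [l tr] := mixed1 k (cst 0) kK; have [uW utr _] := u_sol.
rewrite (tr u Du uW utr) !ip0l subr0 addr0 => mx.
have shL : inLv D p%:E sigmah by exact: (RT0_inLv oD bD lD triT p1' rtsh).
have Ai v : inLv D p%:E v -> inLv D p%:E (Ainv A v).
  exact: (inLv_Ainv oD a0 adm p1').
have AB v w : Ainv A (fun x => v x - w x) = (fun x => Ainv A v x - Ainv A w x).
  by apply/funext => x; rewrite /Ainv mxappB.
rewrite (AB sigmah tau) (ipvBl oD p1' q1 pq (Ai _ shL) (Ai _ tauL) kL) mx.
rewrite (@eq_ae_ipv _ D (Ainv A (fun x => sigma x - tau x))
  (fun x => ((- Du x) - Ainv A (f2 x0) x) - Ainv A tau x)).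
  rewrite (ipvBl oD p1' q1 pq (inLvB oD p1' (inLvN DuL) (Ai _ f2L)) (Ai _ tauL) kL).
  by rewrite (ipvBl oD p1' q1 pq (inLvN DuL) (Ai _ f2L) kL) ipvNl//
    (ipvC D Du) [X in X - _ = _]addrC.
apply: filterS (Ainv_Aapp a0 adm Du) => x h Dx; rewrite -h//.
rewrite !AB; congr (_ - _ - _).
by rewrite /Ainv /mxapp /= !mulrN -!opprD.
Qed.

Variables (C C0 CSP : R).
Hypotheses (poinc : poincare_constant T q C) (C00 : 0 < C0) (CSP0 : 0 <= CSP).
Hypothesis stability : forall rho r, inLv D p%:E rho -> is_Rh D T A rho r ->
  (normLv D p%:E r <= C0%:E * normLv D p%:E rho + CSP%:E * norm_divW D q rho)%E.

(** The error is the flux error of the competitor minus its projection, and the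
    divergence of the former only sees the oscillation of the load. *)
Lemma competitor_estimate :
  (normLv D p%:E (fun x => (sigma x - sigmah x)%R)
    <= (1 + C0)%:E * normLv D p%:E (fun x => (sigma x - tau x)%R)
       + (C * CSP * mesh_size T)%:E * normL D p%:E (fun x => (f1 x - Qh T f1 x)%R))%E.
Proof.
have [dsh [rtsh _ _ _]] := h_sol.
have shL : inLv D p%:E sigmah by exact: (RT0_inLv oD bD lD triT p1' rtsh).
have rL : inLv D p%:E (fun x => tau x - sigmah x) by exact: inLvB.
have [rho1 rho2 _] := (inLvP mD _ p1').1 rhoL.
have [r1 r2 _] := (inLvP mD _ p1').1 rL.
have split_error : (normLv D p%:E (fun x => (sigma x - sigmah x)%R) <=
    normLv D p%:E (fun x => (sigma x - tau x)%R) +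
    normLv D p%:E (fun x => (sigmah x - tau x)%R))%E.
  rewrite (_ : (fun x => sigma x - sigmah x) =
    (fun x => (sigma x - tau x) + (tau x - sigmah x))); last first.
    by apply/funext => x; rewrite addrA subrK.
  rewrite -(normLvN D p (fun x => sigmah x - tau x)).
  rewrite (_ : (fun x => - (sigmah x - tau x)) = (fun x => tau x - sigmah x)); last first.
    by apply/funext => x; rewrite opprB.
  exact: normLvD.
apply: le_trans split_error _.
set N := normLv D p%:E (fun x => sigma x - tau x).
have -> : ((1 + C0)%:E * N = N + C0%:E * N)%E.
  by rewrite EFinD ge0_muleDl ?lee_fin ?(ltW C00)// mul1e.
rewrite -addeA leeD2l//.
apply: le_trans (stability rhoL discrete_error_is_Rh) _; rewrite leeD2l//.
have dW := norm_divW_le oD bD lD triT p1' q1 pq poinc rhoL f1L f1i flux_error_divergence.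
apply: le_trans (lee_wpmul2l _ dW) _; first by rewrite lee_fin.
by rewrite muleA -EFinM mulrCA mulrA.
Qed.

End competitor.

End error_estimate.

Theorem theorem4p4 (R : realType)
  (p : R) (p_gt1 : 1 < p) (p_lt2 : p < 2)
  (CP : R -> R -> R)
  (Omega : set (R * R))
  (Omega_dom : bounded_simply_connected_lipschitz_domain Omega)
  (ds : {measure set (mplane R) -> \bar R})
  (ds_surf : is_surface_measure Omega ds)
  (x0 : R * R) (x0_in : Omega x0)
  (alpha beta : R) (alpha_gt0 : 0 < alpha) (alpha_le_beta : alpha <= beta)
  (A : R * R -> 'M[R]_2) (A_ell : admissible_coefficient Omega A alpha beta)
  (f1 : R * R -> R) (f1_Lp : inL Omega p%:E f1)
  (g : R * R -> R) (g_trace : slobodeckij ds p g)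
  (u : R * R -> R) (Du : R * R -> R * R)
  (u_sol : weak_solution Omega ds p A x0 f1 g u Du)
  (u_uniq : forall v Dv, weak_solution Omega ds p A x0 f1 g v Dv ->
     {ae leb2, forall x, Omega x -> v x = u x})
  (I : Type) (T : I -> mesh R) (kappa : R)
  (T_triang : forall i, triangulation Omega (T i))
  (T_reg : forall i, shape_regular kappa (T i))
  (sigmah : I -> R * R -> R * R) (uh : I -> R * R -> R)
  (h_sol : forall i,
     mixed_solution Omega ds p (T i) A x0 f1 g (sigmah i) (uh i))
  (CP_poincare : forall i, poincare_constant (T i) (p / (p - 1)) (CP p kappa))
  (C0 CSP : R) (C0_gt0 : 0 < C0) (CSP_ge0 : 0 <= CSP)
  (stability : forall i rho r, inLv Omega p%:E rho ->
     is_Rh Omega (T i) A rho r ->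
     (normLv Omega p%:E r
       <= C0%:E * normLv Omega p%:E rho
          + CSP%:E * norm_divW Omega (p / (p - 1)) rho)%E) :
  let sigma := modified_flux A x0 Du in
  forall i,
    (normLv Omega p%:E (fun x => (sigma x - sigmah i x)%R)
      <= (1 + C0)%:E *
           ereal_inf [set normLv Omega p%:E (fun x => (sigma x - tau x)%R)
                     | tau in RT0f Omega (T i) f1]
         + (CP p kappa * CSP * mesh_size (T i))%:E *
           normL Omega p%:E (fun x => (f1 x - Qh (T i) f1 x)%R))%E.
Proof.
move=> sigma i.
have [oD bD _ lD] := Omega_dom.
have mD : measurable (Omega : set (mplane R)) by exact: open_measurable_plane.
set q := p / (p - 1) in stability CP_poincare *.
have p0 : 0 < p by exact: lt_trans p_gt1.
have p1 : 1 <= p by exact: ltW.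
have q1 : 1 <= q.
  by rewrite /q ler_pdivlMr ?subr_gt0// mul1r gerBl.
have pq : p^-1 + q^-1 = 1.
  by rewrite /q; field; rewrite subr_eq0 !gt_eqF.
have triT := T_triang i.
have c0 : 0 < 1 + C0 by rewrite addr_gt0.
set osc := normL _ _ (fun x => f1 x - _).
have osc_fin : osc \is a fin_num.
  rewrite ge0_fin_numE ?normL_ge0//.
  have QL : inL Omega p%:E (Qh (T i) f1).
    by apply: Qh_inL => //; exact: bounded_leb2_fin.
  by have [] := (inLP mD _ _).1 (inLB oD p1 f1_Lp QL).
(* A bound by every competitor is passed to the infimum after isolating it. *)
rewrite -leeBlDr ?fin_numM// -lee_pdivrMl//.
apply: le_ereal_inf_tmp => _ [tau tau_f1 <-].
rewrite lee_pdivrMl// leeBlDr ?fin_numM//.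
have [finite|] := ltP (normLv Omega p%:E (fun x => sigma x - tau x)) +oo%E; last first.
  (* The right-hand side is infinite. *)
  rewrite leye_eq => /eqP ->; rewrite gt0_muley ?lte_fin// addye ?leey//.
  by rewrite gt_eqF// ltNye_eq fin_numM.
have [s1 s2] := measurable_modified_flux oD p_gt1 alpha_gt0 A_ell u_sol.
have tauL : inLv Omega p%:E tau by exact: (RT0_inLv oD bD lD triT p1 tau_f1).
have [t1 t2 _] := (inLvP mD _ p1).1 tauL.
have rhoL : inLv Omega p%:E (fun x => sigma x - tau x).
  apply/(inLvP mD _ p1); split => //.
    by rewrite (_ : fst \o _ = (fun x => (fst \o sigma) x - (fst \o tau) x))//;
      exact: measurable_funB.
  by rewrite (_ : snd \o _ = (fun x => (snd \o sigma) x - (snd \o tau) x))//;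
    exact: measurable_funB.
exact: (competitor_estimate oD bD lD triT p_gt1 q1 pq alpha_gt0 A_ell f1_Lp u_sol
  (h_sol i) tau_f1 rhoL (CP_poincare i) C0_gt0 CSP_ge0 (stability i)).
Qed.
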